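(* Let $\mathfrak g$ be a seven-dimensional real Lie algebra which admits a codimension one Abelian ideal $\mathfrak u$. Let $e_7\in\mathfrak g\setminus\mathfrak u$ and let $\omega\in\Lambda^2\mathfrak u^*$ be a non-degenerate two-form on $\mathfrak u$. Then the following are equivalent: (a) $\mathfrak g$ admits a cocalibrated $\mathrm G_2$-structure. (b) $\mathfrak g$ admits a cocalibrated $\mathrm G_2^*$-structure such that the subspace $\mathfrak u$ is non-degenerate with respect to the induced pseudo-Euclidean metric on $\mathfrak g$. (c) $\mathrm{ad}(e_7)|_{\mathfrak u}\in\mathfrak{gl}(\mathfrak u)$ is similar under $\mathrm{GL}(\mathfrak u)$ to an element of $\mathfrak{sp}(\mathfrak u,\omega)$. (d) The complex Jordan normal form of $\mathrm{ad}(e_7)|_{\mathfrak u}$ has the property that for all $m\in\mathbb N$ and all $\lambda\neq 0$ the number of Jordan blocks of size $m$ with $\lambda$ on the diagonal is the same as the number of Jordan blocks of size $m$ with $-\lambda$ on the diagonal, and (for all $m\in\mathbb N$) the number of Jordan blocks of size $2m-1$ with $0$ on the diagonal is even.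
   Context: Write $e^{ijk}=e^i\wedge e^j\wedge e^k$ etc. Let $V$ be a seven-dimensional real vector space. A $\mathrm G_2$-structure on $V$ is a three-form $\varphi\in\Lambda^3V^*$ such that there is a basis $e_1,\dots,e_7$ of $V$ (an adapted basis) with dual basis $e^1,\dots,e^7$ and $\varphi=e^{127}+e^{347}+e^{567}+e^{135}-e^{146}-e^{236}-e^{245}$. A $\mathrm G_2^*$-structure on $V$ is a three-form $\varphi\in\Lambda^3V^*$ such that there is a basis (adapted basis) with $\varphi=-e^{127}-e^{347}+e^{567}+e^{135}-e^{146}-e^{236}-e^{245}$. Either structure induces uniquely a (pseudo-)Euclidean metric $g$ and a metric volume form $\mathrm{vol}$ on $V$ by $g(v,w)\,\mathrm{vol}=\frac16(v\lrcorner\varphi)\wedge(w\lrcorner\varphi)\wedge\varphi$, such that each adapted basis is an oriented orthonormal basis; $g$ is positive definite for a $\mathrm G_2$-structure, and for a $\mathrm G_2^*$-structure $g(e_i,e_i)=-1$ for $i=1,2,3,4$ and $g(e_j,e_j)=1$ for $j=5,6,7$ in an adapted basis. The Hodge star $\star_\varphi:\Lambda^kV^*\to\Lambda^{7-k}V^*$ is defined by $\psi\wedge\phi=g(\star_\varphi\psi,\phi)\,\mathrm{vol}$ for all $\phi\in\Lambda^{7-k}V^*$. In an adapted basis, $\star_\varphi\varphi=\epsilon(e^{1256}+e^{3456})+e^{1234}-e^{2467}+e^{2357}+e^{1457}+e^{1367}$ with $\epsilon=1$ for $\mathrm G_2$ and $\epsilon=-1$ for $\mathrm G_2^*$. On a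 Lie algebra $\mathfrak g$, $d$ is the exterior derivative on $\Lambda^*\mathfrak g^*$ determined by $(d\alpha)(X,Y)=-\alpha([X,Y])$ for $\alpha\in\mathfrak g^*$. A cocalibrated $\mathrm G_2$- (resp. $\mathrm G_2^*$-) structure on a seven-dimensional real Lie algebra $\mathfrak g$ is a $\mathrm G_2$- (resp. $\mathrm G_2^*$-) structure $\varphi\in\Lambda^3\mathfrak g^*$ with $d\star_\varphi\varphi=0$. $\mathfrak{sp}(\mathfrak u,\omega)=\{f\in\mathfrak{gl}(\mathfrak u):\omega(f v,w)+\omega(v,f w)=0\ \forall v,w\in\mathfrak u\}$. ''Similar under $\mathrm{GL}(\mathfrak u)$'' means conjugate by an element of $\mathrm{GL}(\mathfrak u)$. *)

(* Defs.v *)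
From mathcomp Require Import all_boot all_order all_algebra.
From mathcomp Require Import perm reals complex.

Set Implicit Arguments.
Unset Strict Implicit.
Unset Printing Implicit Defensive.

Import Order.TTheory GRing.Theory Num.Theory.
Local Open Scope ring_scope.

Section Forms.
Context {R : realType} {V : vectType R}.

Definition kform (k : nat) := {ffun 'I_k -> V} -> R.

Definition upd k (x : {ffun 'I_k -> V}) (i : 'I_k) (y : V) :
  {ffun 'I_k -> V} := [ffun j => if j == i then y else x j].

(* k-forms: alternating multilinear maps V^k -> R. *)
Definition is_form k (a : kform k) : Prop :=
  (forall x i (c : R) y z,
     a (upd x i (c *: y + z)) = c * a (upd x i y) + a (upd x i z)) /\
  (forall (x : {ffun 'I_k -> V}) i j, i != j -> x i = x j -> a x = 0).

(* Determinant normalization: for one-forms,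
   (a1 /\ ... /\ ak)(x_1, ..., x_k) = det (a_i (x_j)). *)
Definition wedge p q (a : kform p) (b : kform q) : kform (p + q) := fun x =>
  (p`! * q`!)%:R^-1 *
  \sum_(s : 'S_(p + q)) (-1) ^+ s *
     (a [ffun i => x (s (lshift q i))] * b [ffun j => x (s (rshift p j))]).

(* Interior product: v is inserted in the first slot. *)
Definition contract k (v : V) (a : kform k.+1) : kform k := fun x =>
  a [ffun i => oapp x v (unlift ord0 i)].

Definition gram (g : V -> V -> R) : 'M[R]_(\dim {:V}) :=
  \matrix_(i, j) g (vbasis {:V})`_i (vbasis {:V})`_j.

(* Inner product induced by the metric g on k-forms, in coordinates:
   (1/k!) g^{i1 j1} ... g^{ik jk} a_{i1 ... ik} b_{j1 ... jk};
   the value does not depend on the basis used. *)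
Definition form_inner k (g : V -> V -> R) (a b : kform k) : R :=
  k`!%:R^-1 *
  \sum_(I : {ffun 'I_k -> 'I_(\dim {:V})})
  \sum_(J : {ffun 'I_k -> 'I_(\dim {:V})})
     (\prod_(l < k) invmx (gram g) (I l) (J l)) *
     a [ffun l => (vbasis {:V})`_(I l)] * b [ffun l => (vbasis {:V})`_(J l)].

Definition is_hodge_star p q (g : V -> V -> R) (vol : kform (p + q))
    (psi : kform p) (star : kform q) : Prop :=
  is_form star /\
  forall phi : kform q, is_form phi ->
    forall x, wedge psi phi x = form_inner g star phi * vol x.

(* Exterior derivative of left-invariant forms on a Lie algebra
   (Chevalley-Eilenberg differential). The textbook formula
     sum_(i < j) (-1)^(i+j) a([x_i, x_j], x_0, ..^i..^j.., x_k)
   is written here with [x_i, x_j] moved from the first slot to slot i, which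
   cancels the factor (-1)^i. *)
Definition ext_d (br : V -> V -> V) k (a : kform k) : kform k.+1 := fun x =>
  \sum_(i < k) \sum_(j < k.+1 | (i < j)%N) (-1) ^+ j *
     a [ffun l => if l == i then br (x (widen_ord (leqnSn k) i)) (x j)
                  else x (lift j l)].

Lemma ext_d1 (br : V -> V -> V) (a : kform 1) (x : {ffun 'I_2 -> V}) :
  ext_d br a x = - a [ffun=> br (x ord0) (x ord_max)].
Proof.
rewrite /ext_d big_ord1 big_mkcond big_ord_recl big_ord1 /= add0r expr1 mulN1r.
congr (- a _); apply/ffunP => l; rewrite !ffunE [l]ord1 eqxx.
by congr (br (x _) (x _)); apply: val_inj.
Qed.

End Forms.

Arguments kform {R} V k.

Section Structures.
Context {R : realType} {V : vectType R}.
Implicit Types (e : 7.-tuple V) (phi : kform V 3) (vol : kform V 7).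
Implicit Types (g : {symmetric V}) (br : V -> V -> V).

(* Dual basis, numbered from 1 to 7. *)
Definition dual1 e (i : nat) : kform V 1 := fun x => coord e (inord i.-1) (x ord0).

Definition dual3 e (i j k : nat) : kform V 3 :=
  wedge (wedge (dual1 e i) (dual1 e j)) (dual1 e k).

Definition G2_model e : kform V 3 := fun x =>
  dual3 e 1 2 7 x + dual3 e 3 4 7 x + dual3 e 5 6 7 x + dual3 e 1 3 5 x
  - dual3 e 1 4 6 x - dual3 e 2 3 6 x - dual3 e 2 4 5 x.

Definition G2star_model e : kform V 3 := fun x =>
  - dual3 e 1 2 7 x - dual3 e 3 4 7 x + dual3 e 5 6 7 x + dual3 e 1 3 5 x
  - dual3 e 1 4 6 x - dual3 e 2 3 6 x - dual3 e 2 4 5 x.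

(* Below, [model] is G2_model or G2star_model. *)
Definition adapted (model : 7.-tuple V -> kform V 3) phi e : Prop :=
  basis_of fullv e /\ phi =1 model e.

Definition is_structure (model : 7.-tuple V -> kform V 3) phi : Prop :=
  is_form phi /\ exists e, adapted model phi e.

Definition oriented_orthonormal g vol e : Prop :=
  [/\ vol [ffun i => tnth e i] = 1,
      forall i, `|g (tnth e i) (tnth e i)| = 1 &
      forall i j, i != j -> g (tnth e i) (tnth e j) = 0].

Definition induces (model : 7.-tuple V -> kform V 3) phi g vol : Prop :=
  [/\ is_form vol,
      forall v w (x : {ffun 'I_7 -> V}), g v w * vol x =
        6^-1 * wedge (wedge (contract v phi) (contract w phi)) phi x &
      forall e, adapted model phi e -> oriented_orthonormal g vol e].

Definition cocalibrated (model : 7.-tuple V -> kform V 3) br phi g vol : Prop :=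
  [/\ is_structure model phi, induces model phi g vol &
      exists2 star : kform V 4, is_hodge_star (p := 3) g vol phi star &
        forall x, ext_d br star x = 0].

Definition nondegenerate_on g (u : {vspace V}) : Prop :=
  (u :&: orthov g u = 0)%VS.

Definition is_lie_bracket br : Prop :=
  (forall x, br x x = 0) /\
  (forall x y z, br x (br y z) + br y (br z x) + br z (br x y) = 0).

Definition is_abelian_ideal br (u : {vspace V}) : Prop :=
  (forall x y, y \in u -> br x y \in u) /\
  (forall x y, x \in u -> y \in u -> br x y = 0).

(* ad(x)|_u; the projection vsproj is the identity on the values br x v when u
   is an ideal. *)
Definition ad_on br (u : {vspace V}) (x : V) : 'End(subvs_of u) :=
  linfun (fun v : subvs_of u => vsproj u (br x (vsval v))).

End Structures.

Definition in_sp (R : realType) (U : vectType R) (omega : {skew_symmetric U})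
    (f : 'End(U)) : Prop :=
  forall v w, omega (f v) w + omega v (f w) = 0.

Definition is_similar (R : realType) (U : vectType R) (f h : 'End(U)) : Prop :=
  exists2 P : 'End(U), lker P == 0%VS & h = (P \o f \o P^-1)%VF.

Definition jordan_block (F : fieldType) (m : nat) (l : F) : 'M[F]_m :=
  \matrix_(i, j) (l *+ (i == j) + (i.+1 == j)%:R).

(* s lists the blocks as pairs (diagonal entry, size). *)
Definition jordan_mx (F : fieldType) (s : seq (F * nat)) :=
  \mxdiag_(i < size s) jordan_block (nth (0, 0%N) s i).2 (nth (0, 0%N) s i).1.

(* The size of jordan_mx s equals n only propositionally, hence the
   rectangular but mutually inverse matrices P and Q. *)
Definition is_jordan_form (F : fieldType) (n : nat) (A : 'M[F]_n)
    (s : seq (F * nat)) : Prop :=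
  all (fun b => 0 < b.2)%N s /\
  exists P Q, [/\ P *m Q = 1%:M, Q *m P = 1%:M & A = P *m jordan_mx s *m Q].

(* The matrix of f on row vectors of coordinates; passing to the transpose
   does not change the Jordan form. *)
Definition complex_matrix (R : realType) (U : vectType R) (f : 'End(U)) :
    'M[complex R]_(\dim {:U}) :=
  \matrix_(i, j) real_complex R (coord (vbasis {:U}) j (f (vbasis {:U})`_i)).

(* Main.v *)
Require Import Defs.
From HB Require Import structures.
From mathcomp Require Import all_boot all_order all_algebra.
From mathcomp Require Import fingroup perm reals complex zify ring.

(** Let A be the matrix of ad(e7) on the ideal u, acting on row vectors.  The
    four conditions are each shown to be equivalent to the existence of an
    invertible skew-symmetric S with A S + S A^T = 0, that is, of a symplectic
    form on u for which ad(e7) is skew ([sp_mx]).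

    Condition (c) says this up to the choice of the symplectic form, and all
    symplectic forms are equivalent ([darboux], [sp_similarP]).

    For (d) ([sp_mx_jordan]): an invariant S makes (A - l)^k and (A + l)^k
    equivalent up to transposition, and makes A^(2k) S skew-symmetric, hence of
    even rank.  The numbers of Jordan blocks are second differences of the ranks
    of the powers of A - l, so both conditions on blocks follow.  Conversely an
    explicit antidiagonal form pairs the block (l, m) with (-l, m), or the block
    (0, m) with itself when m is even; the resulting complex S is replaced by a
    real one because a polynomial with a nonzero value at i has a nonzero value
    at some real number ([sp_mx_descent]).

    From a cocalibrated structure to S ([cocalibrated_sp]): let n be orthogonal
    to u, which is not null because u is nondegenerate, and let w be the
    restriction to u of the contraction of phi with n.  An algebraic identity
    ([star_contract]) says that w /\ w is 2 g(n, n) times the restriction of the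
    dual 4-form to u.  As u is an abelian ideal, closedness of the 4-form,
    evaluated on e7 and four vectors of u, says that the action of ad(e7) kills
    w /\ w, that is, (ad(e7) . w) /\ w = 0.  In dimension 6 the product with the
    nondegenerate form w is injective on 2-forms ([lefschetz]), so
    ad(e7) . w = 0.

    From S back to cocalibrated structures ([sp_cocalibrated]): a Darboux basis
    of u followed by e7 is declared to be adapted.  The dual 4-form is then
    w^2 / 2 + e^7 /\ rho, where w is the invariant form and rho a 3-form on u.  The
    first term is closed because w is invariant, the second because the exterior
    derivative only produces multiples of e^7.  This works for both signatures
    and gives (a) and (b); for the definite metric every subspace is
    nondegenerate ([cocalibrated_nondegenerate]).

    That the metric, volume form and Hodge star of a structure are the
    expected ones in an adapted basis is a finite computation with monomials in
    the dual basis ([induces_ip], [model_hodge_unique], [model_cocalibrated]). *)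

Set Implicit Arguments.
Unset Strict Implicit.
Unset Printing Implicit Defensive.

Import Order.TTheory GRing.Theory Num.Theory.
Local Open Scope ring_scope.

(** * Similarity of matrices *)

Section Similar.
Context {F : fieldType}.

(** The two sizes are allowed to differ so that similarity with a block matrix
    does not need casts between provably equal dimensions. *)
Definition simmx n m (A : 'M[F]_n) (B : 'M[F]_m) : Prop :=
  exists P Q, [/\ P *m Q = 1%:M, Q *m P = 1%:M & A = P *m B *m Q].

Lemma simmx_refl n (A : 'M_n) : simmx A A.
Proof. by exists 1%:M, 1%:M; rewrite !mul1mx mulmx1. Qed.

Lemma simmx_trans n m p (A : 'M_n) (B : 'M_m) (C : 'M_p) :
  simmx A B -> simmx B C -> simmx A C.
Proof.
move=> [P [Q [PQ QP ->]]] [P' [Q' [PQ' QP' ->]]].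
exists (P *m P'), (Q' *m Q); rewrite !mulmxA; split=> //.
  by rewrite -(mulmxA P) PQ' mulmx1 PQ.
by rewrite -(mulmxA Q') QP mulmx1 QP'.
Qed.

Lemma simmx_cast n m (A : 'M_n) (e : n = m) : simmx (castmx (e, e) A) A.
Proof. by case: m / e; rewrite castmx_id; apply: simmx_refl. Qed.

Lemma simmx_block n n' m m' (A : 'M_n) (A' : 'M_n') (B : 'M_m) (B' : 'M_m') :
  simmx A A' -> simmx B B' -> simmx (block_mx A 0 0 B) (block_mx A' 0 0 B').
Proof.
move=> [P [Q [PQ QP ->]]] [P' [Q' [PQ' QP' ->]]].
exists (block_mx P 0 0 P'), (block_mx Q 0 0 Q').
by rewrite !mulmx_block !(mulmx0, mul0mx, addr0, add0r) PQ QP PQ' QP' -!scalar_mx_block.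
Qed.

Lemma simmx_shift n m (A : 'M_n) (B : 'M_m) l :
  simmx A B -> simmx (A - l%:M) (B - l%:M).
Proof.
move=> [P [Q [PQ QP ->]]]; exists P, Q; split=> //.
by rewrite mulmxBr mulmxBl scalar_mxC -[_ *m P *m Q]mulmxA PQ mulmx1.
Qed.

Lemma simmx_exp n m (A : 'M_n) (B : 'M_m) k :
  simmx A B -> simmx (A ^+ k) (B ^+ k).
Proof.
move=> [P [Q [PQ QP ->]]]; exists P, Q; split=> //.
elim: k => [|k IHk]; first by rewrite !expr0 mulmx1 PQ.
rewrite !exprS IHk -!mulmxE !mulmxA.
by rewrite -(mulmxA (P *m B)) QP mulmx1.
Qed.

Lemma simmx_rank n m (A : 'M_n) (B : 'M_m) : simmx A B -> \rank A = \rank B.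
Proof.
move=> [P [Q [PQ QP AE]]]; apply/eqP; rewrite eqn_leq; apply/andP; split.
  by rewrite AE (leq_trans (mxrankM_maxl _ _)) ?mxrankM_maxr.
have -> : B = Q *m A *m P by rewrite AE !mulmxA QP mul1mx -mulmxA QP mulmx1.
by rewrite (leq_trans (mxrankM_maxl _ _)) ?mxrankM_maxr.
Qed.

End Similar.

(** * Jordan blocks and ranks of powers *)

Section JordanRank.
Context {F : fieldType}.

Lemma mxdiagM p (p_ : 'I_p -> nat) (B C : forall i, 'M[F]_(p_ i)) :
  (\mxdiag_i B i) *m (\mxdiag_i C i) = \mxdiag_i (B i *m C i).
Proof.
rewrite [X in _ *m X]/mxdiag mul_mxdiag_mxblock /mxdiag.
apply: eq_mxblock => i j; case: eqVneq => [<-|]; last by rewrite mulmx0.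
by rewrite !conform_mx_id.
Qed.

Lemma mxdiagX p (p_ : 'I_p -> nat) (B : forall i, 'M[F]_(p_ i)) k :
  (\mxdiag_i B i) ^+ k = \mxdiag_i (B i ^+ k).
Proof.
elim: k => [|k IHk]; first by rewrite -[LHS]/(1%:M) -mxdiagZ.
by rewrite exprS IHk -mulmxE mxdiagM; apply: eq_mxdiag => i; rewrite exprS.
Qed.

Lemma jordan_block_shift m (l c : F) :
  jordan_block m l - c%:M = jordan_block m (l - c).
Proof.
apply/matrixP => i j; by rewrite !mxE mulrnBl addrAC.
Qed.

Lemma jordan_block_unit m (l : F) : l != 0 -> jordan_block m l \in unitmx.
Proof.
move=> l0; rewrite unitmxE -det_tr det_trig.
  rewrite (eq_bigr (fun=> l)) ?prodr_const ?unitrX ?unitfE // => i _.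
  by rewrite !mxE eqxx mulr1n gtn_eqF // addr0.
apply/is_trig_mxP => i j lt_ij; rewrite !mxE [j == i](negbTE _) ?mulr0n ?add0r.
  by rewrite gtn_eqF // ltnW.
by rewrite neq_ltn lt_ij orbT.
Qed.

Lemma jordan_block0X m k :
  jordan_block m (0 : F) ^+ k = \matrix_(i, j) (i + k == j)%N%:R.
Proof.
elim: k => [|k IHk]; apply/matrixP => i j.
  by rewrite expr0 !mxE addn0.
rewrite exprS IHk -mulmxE !mxE.
have [lt_im|ge_im] := ltnP i.+1 m; last first.
  rewrite big1 => [|h _]; last first.
    by rewrite !mxE mul0rn add0r (gtn_eqF (leq_trans (ltn_ord h) ge_im)) mul0r.
  by rewrite eqn_leq [X in X && _]leqNgt (leq_trans (ltn_ord j)) // (leq_trans ge_im) // addnS ltnS leq_addr.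
rewrite (bigD1 (Ordinal lt_im)) //= !mxE mul0rn add0r eqxx mul1r big1 ?addr0 ?addSnnS //.
move=> h hi; rewrite !mxE mul0rn add0r (_ : (_ == _ :> nat) = false) ?mul0r //.
by apply/negbTE; move: hi; rewrite -val_eqE /= eq_sym.
Qed.

Lemma rank_jordan_block0X m k : \rank (jordan_block m (0 : F) ^+ k) = (m - k)%N.
Proof.
rewrite jordan_block0X; set E := \matrix_(_, _) _.
have EE : E *m E^T = pid_mx (m - k).
  apply/matrixP => i j; rewrite !mxE.
  have [lt_i|ge_i] := ltnP (i + k)%N m; last first.
    rewrite [X in (_ && X)](_ : _ = false) ?andbF; last first.
      by apply/negbTE; rewrite -leqNgt leq_subLR addnC.
    by rewrite big1 // => h _; rewrite !mxE gtn_eqF ?mul0r // (leq_trans _ ge_i).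
  rewrite (bigD1 (Ordinal lt_i)) //= big1 ?addr0 => [|h hi]; last first.
    rewrite !mxE (_ : (_ == _ :> nat) = false) ?mul0r //.
    by apply/negbTE; move: hi; rewrite -val_eqE /= eq_sym.
  by rewrite !mxE eqxx mul1r eqn_add2r ltn_subRL addnC lt_i andbT eq_sym.
have ME : pid_mx (m - k) *m E = E.
  apply/matrixP => i j; rewrite !mxE (bigD1 i) //= big1 ?addr0 => [|h hi]; last first.
    by rewrite !mxE [i == h :> nat]eq_sym (negbTE (hi : h != i :> nat)) mul0r.
  rewrite !mxE eqxx /= ltn_subRL addnC; case: ltnP; rewrite ?mul1r // mul0r => ge_i.
  by rewrite gtn_eqF // (leq_trans _ ge_i).
apply/eqP; rewrite eqn_leq; apply/andP; split.
  rewrite -ME (leq_trans (mxrankM_maxl _ _)) // rank_pid_mx ?leq_subr //.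
by rewrite -{1}(@rank_pid_mx F m m (m - k)) ?leq_subr // -EE mxrankM_maxl.
Qed.

(** The contribution of one block b to the rank of (A - l)^k: a nilpotent block
    loses k, an invertible one loses nothing. *)
Definition block_rank (l : F) k (b : F * nat) : nat :=
  if b.1 == l then (b.2 - k)%N else b.2.

Lemma rank_jordan_mx (s : seq (F * nat)) l k :
  \rank ((jordan_mx s - l%:M) ^+ k) = (\sum_(b <- s) block_rank l k b)%N.
Proof.
rewrite /jordan_mx -mxdiagZ -mxdiagB mxdiagX rank_mxdiag (big_nth (0, 0%N)) big_mkord.
apply: eq_bigr => i _; rewrite jordan_block_shift /block_rank -subr_eq0.
set b := nth _ _ _; have [->|nz] := eqVneq (b.1 - l) 0.
  exact: rank_jordan_block0X.
apply: mxrank_unit; elim: k => [|k IHk]; first by rewrite expr0 unitmx1.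
by rewrite exprS unitmx_mul IHk jordan_block_unit.
Qed.

(** Subtraction-free form of the second difference of ranks: the rank drop
    from (A - l)^k to (A - l)^(k+1) counts the blocks for l of size above k. *)
Lemma count_jordan_blocks n (A : 'M[F]_n) s l k : is_jordan_form A s ->
  (\rank ((A - l%:M) ^+ k) + \rank ((A - l%:M) ^+ k.+2) =
   (\rank ((A - l%:M) ^+ k.+1)).*2 + count_mem (l, k.+1) s)%N.
Proof.
case=> _ simA; have rE j : \rank ((A - l%:M) ^+ j) = (\sum_(b <- s) block_rank l j b)%N.
  by rewrite -rank_jordan_mx; apply/simmx_rank/simmx_exp/simmx_shift.
have -> : count_mem (l, k.+1) s = (\sum_(b <- s) (b == (l, k.+1)))%N.
  by rewrite -sum1_count big_mkcond; apply: eq_bigr => b _ /=; case: eqP.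
rewrite !rE -mul2n big_distrr -!big_split /=.
apply: eq_bigr => -[a m] _; rewrite /block_rank xpair_eqE /=.
by case: (a == l) => /=; lia.
Qed.
(** If row a of V is the a-th term of a Jordan chain f ending in f m = 0, then
    multiplication by the Jordan block shifts along the chain. *)
Lemma mul_jordan_block m p l (V : 'M[F]_(m, p)) (f : nat -> 'I_p -> F) :
    (forall a k, V a k = f a k) -> (forall k, f m k = 0) ->
  forall a k, (jordan_block m l *m V) a k = l * f a k + f a.+1 k.
Proof.
move=> Vf fm a k; rewrite !mxE.
under eq_bigr do rewrite !mxE mulrDl Vf.
rewrite big_split /=; congr (_ + _).
  rewrite (bigD1 a) //= eqxx mulr1n big1 ?addr0 // => b ba.
  by rewrite eq_sym (negbTE ba) mul0r.
have [lt_a|ge_a] := ltnP a.+1 m; last first.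
  rewrite (_ : a.+1 = m) ?fm; last by apply/eqP; rewrite eqn_leq ge_a ltn_ord.
  by rewrite big1 // => b _; rewrite gtn_eqF ?mul0r.
rewrite (bigD1 (Ordinal lt_a)) //= eqxx mul1r big1 ?addr0 // => b ba.
by rewrite eq_sym (negbTE (ba : b != a.+1 :> nat)) mul0r.
Qed.

End JordanRank.

(** * Skew-symmetric matrices and the symmetry of the Jordan form *)

Section SkewRank.
Context {F : fieldType} (char2 : (2%:R : F) != 0).

Lemma skew_unitmx_even n (S : 'M[F]_n) : S^T = - S -> S \in unitmx -> ~~ odd n.
Proof.
move=> skS; rewrite unitmxE unitfE => dS; apply/negP => odd_n; case/negP: dS.
have := det_tr S; rewrite skS -scaleN1r detZ -signr_odd odd_n expr1 mulN1r => /eqP.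
by rewrite -subr_eq0 -opprD oppr_eq0 -mulr2n -mulr_natl mulf_eq0 (negbTE char2).
Qed.

(** On a basis B of the row space, S = B^T X B with X skew-symmetric and
    invertible of size the rank of S; an invertible skew-symmetric matrix has
    even size because of its determinant. *)
Lemma skew_rank_even n (S : 'M[F]_n) : S^T = - S -> ~~ odd (\rank S).
Proof.
move=> skS.
have [r [B [rE freeB eqB]]] : exists r (B : 'M_(r, n)),
    [/\ \rank S = r, row_free B & (B :=: S)%MS].
  by exists (\rank S), (row_base S); rewrite row_base_free; split=> //; apply: eq_row_base.
rewrite rE.
have [B' BB'] : exists B', B *m B' = 1%:M by apply/row_freeP.
have [C SE] : exists C, S = C *m B by apply/submxP; rewrite eqB.
have [X CE] : exists X, C^T = X *m B.
  apply/submxP; rewrite eqB.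
  have -> : C^T = B'^T *m - S.
    by rewrite -skS SE trmx_mul mulmxA -trmx_mul BB' trmx1 mul1mx.
  by rewrite mulmxN -mulNmx submxMl.
have {SE} SE : S = B^T *m X^T *m B by rewrite -trmx_mul -CE trmxK -SE.
have XE : X^T = B'^T *m S *m B'.
  by rewrite SE !mulmxA -trmx_mul BB' trmx1 mul1mx -mulmxA BB' mulmx1.
apply: (@skew_unitmx_even _ X^T).
  by rewrite XE !trmx_mul skS trmxK mulNmx mulmxN mulmxA.
rewrite -row_full_unit -col_leq_rank -{1}rE {1}SE.
by rewrite (leq_trans (mxrankM_maxl _ _)) ?mxrankM_maxr.
Qed.
End SkewRank.

(** S is the Gram matrix of a symplectic form that is infinitesimally invariant
    under the endomorphism with matrix A on row vectors. *)
Definition sp_mx {F : fieldType} n (A S : 'M[F]_n) : Prop :=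
  [/\ S^T = - S, S \in unitmx & A *m S + S *m A^T = 0].

Section SpectrumSymmetry.
Context {F : fieldType} (char2 : (2%:R : F) != 0) (n : nat) (A S : 'M[F]_n).
Hypothesis spAS : sp_mx A S.

(** Invariance moves A across S with a change of sign, hence turns A - l into
    the transpose of -(A + l). *)
Lemma sp_mx_shiftX l k :
  (A - l%:M) ^+ k *m S = (-1) ^+ k *: (S *m ((A + l%:M) ^+ k)^T).
Proof.
case: spAS => _ _ /eqP; rewrite addr_eq0 => /eqP AS.
elim: k => [|k IHk]; first by rewrite !expr0 scale1r mul1mx trmx1 mulmx1.
rewrite exprSr -mulmxE -mulmxA mulmxBl AS -scalar_mxC.
rewrite (_ : - (S *m A^T) - _ = - (S *m (A + l%:M)^T)); last first.
  by rewrite linearD /= tr_scalar_mx mulmxDr opprD.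
rewrite mulmxN mulmxA IHk -scalemxAl exprS mulN1r scaleNr -mulmxA.
by rewrite -trmx_mul mulmxE -exprS.
Qed.

Lemma rank_sp_shift l k : \rank ((A - l%:M) ^+ k) = \rank ((A + l%:M) ^+ k).
Proof.
case: spAS => _ uS _; rewrite -(mxrankMfree _ (_ : row_free S)) ?row_free_unit //.
rewrite sp_mx_shiftX mxrank_scale_nz ?signr_eq0 // eqmxMfull ?mxrank_tr //.
by rewrite row_full_unit.
Qed.

(** By the previous sign rule an even power of A, times S, is skew-symmetric. *)
Lemma rank_sp_even k : ~~ odd (\rank (A ^+ k.*2)).
Proof.
case: spAS => skS uS _; rewrite -(mxrankMfree _ (_ : row_free S)) ?row_free_unit //.
apply: skew_rank_even => //; have := sp_mx_shiftX 0 k.*2.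
rewrite raddf0 subr0 addr0 -signr_odd odd_double expr0 scale1r => E.
by rewrite E trmx_mul trmxK skS mulmxN -E.
Qed.

(** The ranks of the powers determine the numbers of blocks.  For the eigenvalue
    0 and odd sizes, the second difference involves the two ranks of even powers,
    which are even, and twice another rank. *)
Lemma sp_jordan_count s : is_jordan_form A s ->
  (forall k l, count_mem (l, k) s = count_mem (- l, k) s) /\
  (forall k, ~~ odd (count_mem (0, k.*2.+1) s)).
Proof.
move=> jA; split=> [[|k] l|k].
  have [/allP pos _] := jA.
  by rewrite !(count_memPn _) //; apply/negP => /pos.
  have := count_jordan_blocks l k jA; have := count_jordan_blocks (- l) k jA.
  have opp j : \rank ((A - (- l)%:M) ^+ j) = \rank ((A - l%:M) ^+ j).
    by rewrite rank_sp_shift raddfN.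
  by rewrite !opp => -> /addnI.
have := count_jordan_blocks 0 k.*2 jA; rewrite raddf0 subr0 => /(congr1 odd).
rewrite !oddD odd_double (negbTE (rank_sp_even _)) -doubleS (negbTE (rank_sp_even _)).
by move=> /= <-.
Qed.
End SpectrumSymmetry.

(** * Existence of the Jordan form *)

Section JordanExistence.
Context {F : closedFieldType}.

Lemma simmx_sym n m (A : 'M[F]_n) (B : 'M[F]_m) : simmx A B -> simmx B A.
Proof.
move=> [P [Q [PQ QP ->]]]; exists Q, P; split=> //.
by rewrite !mulmxA QP mul1mx -mulmxA QP mulmx1.
Qed.

Lemma jordan_mx_cons (b : F * nat) s :
  simmx (jordan_mx (b :: s)) (block_mx (jordan_block b.2 b.1) 0 0 (jordan_mx s)).
Proof. by rewrite [jordan_mx (b :: s)]mxdiag_recl; apply: simmx_cast. Qed.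

(** Let (X - l)^(m+1) q be the minimal polynomial of A with q(l) nonzero, and put
    N = A - l, M = q(A).  Some entry (i, j) of M N^m M is nonzero.  For
    a, b <= m let row a of V be row i of M N^a and column b of W be column j of
    N^b M.  The entries (M N^(a+b) M)_ij of V W form a matrix that is zero below the
    antidiagonal and constant nonzero on it, hence invertible.  So the row space of V
    gives a Jordan block and the left kernel of W is an invariant complement. *)
Lemma split_jordan_block n (A : 'M[F]_n) : (0 < n)%N ->
  exists l m r (B : 'M[F]_r), [/\ (0 < m)%N, (r < n)%N &
    simmx A (block_mx (jordan_block m l) 0 0 B)].
Proof.
case: n A => // n A _; set p := mxminpoly A.
have [l rpl] : exists l, root p l.
  by apply/closed_rootP; rewrite size_mxminpoly eqSS -lt0n mxminpoly_nonconstant.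
have p0 : p != 0 by rewrite monic_neq0 ?mxminpoly_monic.
have [m [q]] := multiplicity_XsubC p l.
rewrite p0 /= => rql pE; case: m pE => [|m] pE.
  by rewrite pE expr0 mulr1 (negbTE rql) in rpl.
pose N := A - l%:M; pose M := horner_mx A q.
have hN : horner_mx A ('X - l%:P) = N by rewrite rmorphB /= horner_mx_X horner_mx_C.
have MNm : M *m N ^+ m.+1 = 0.
  by rewrite -hN -rmorphXn mulmxE -rmorphM -pE; apply: mx_root_minpoly.
have comMN k : N ^+ k *m M = M *m N ^+ k.
  by rewrite -hN -rmorphXn !mulmxE -!rmorphM mulrC.
have /matrix0Pn [i [j nz]] : M *m N ^+ m *m M != 0.
  rewrite -hN -rmorphXn !mulmxE -!rmorphM; apply/negP => /eqP /mxminpoly_min.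
  rewrite -/p pE exprSr mulrA dvdp_mul2l; last first.
    by apply: contra p0; rewrite pE exprSr mulrA => /eqP ->; rewrite mul0r.
  by rewrite dvdp_XsubCl (negbTE rql).
pose V := \matrix_(a < m.+1, k < n.+1) (M *m N ^+ a) i k.
pose W := \matrix_(k < n.+1, b < m.+1) (N ^+ b *m M) k j.
have VWE a b : (V *m W) a b = (M *m N ^+ (a + b) *m M) i j.
  rewrite exprD -mulmxE mulmxA -[_ *m _ *m M]mulmxA !mxE.
  by apply: eq_bigr => k _; rewrite !mxE.
have VW0 (a b : 'I_m.+1) : (m < a + b)%N -> (V *m W) a b = 0.
  by move=> mab; rewrite VWE -(subnKC mab) exprD -mulmxE mulmxA MNm !mul0mx mxE.
have uVW : V *m W \in unitmx.
  (* Reversing the columns makes V W triangular. *)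
  pose s : 'S_m.+1 := perm (@rev_ord_inj m.+1).
  suff : col_perm s (V *m W) \in unitmx.
    by rewrite col_permE unitmx_mul => /andP [].
  have sE a b : (col_perm s (V *m W))^T a b = (V *m W) b (rev_ord a).
    by rewrite 2!mxE permE.
  rewrite unitmxE -det_tr det_trig; last first.
    by apply/is_trig_mxP => a b ab; rewrite sE VW0 //=; have := ltn_ord a; lia.
  rewrite (eq_bigr (fun=> (M *m N ^+ m *m M) i j)) => [|a _].
    by rewrite prodr_const unitrX // unitfE.
  by rewrite sE VWE /= subSS subnKC // -ltnS.
set G := invmx (V *m W) in uVW *.
have AE : A = l%:M + N by rewrite addrC subrK.
have VA : V *m A = jordan_block m.+1 l *m V.
  apply/matrixP => a k; rewrite (mul_jordan_block _ (f := fun a k => (M *m N ^+ a) i k)).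
  - rewrite exprSr -mulmxE mulmxA {1}AE mulmxDr mul_mx_scalar !mxE; congr (_ + _).
    by apply: eq_bigr => h _; rewrite !mxE.
  - by move=> *; rewrite mxE.
  - by move=> h; rewrite MNm mxE.
have AW : A *m W = W *m (jordan_block m.+1 l)^T.
  apply: trmx_inj; rewrite !trmx_mul trmxK; apply/matrixP => b k.
  rewrite (mul_jordan_block _ (f := fun b k => (N ^+ b *m M) k j)).
  - rewrite exprS -mulmxE -mulmxA {1}AE linearD /= tr_scalar_mx mulmxDr mul_mx_scalar !mxE.
    by congr (_ + _); apply: eq_bigr => h _; rewrite !mxE mulrC.
  - by move=> *; rewrite !mxE.
  - by move=> h; rewrite comMN MNm mxE.
pose K := row_base (kermx W); have freeK : row_free K by apply: row_base_free.
have [K' KK'] : exists K', K *m K' = 1%:M by apply/row_freeP.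
have KW : K *m W = 0 by apply/sub_kermxP; rewrite eq_row_base.
have [B KA] : exists B, K *m A = B *m K.
  by apply/submxP; rewrite eq_row_base; apply/sub_kermxP; rewrite -mulmxA AW mulmxA KW mul0mx.
(* E projects onto the left kernel of W along the span of V. *)
pose E := 1%:M - W *m G *m V.
have [Y EE] : exists Y, E = Y *m K.
  apply/submxP; rewrite eq_row_base; apply/sub_kermxP.
  by rewrite mulmxBl mul1mx -!mulmxA mulVmx // mulmx1 subrr.
have VE : V *m E = 0.
  by rewrite mulmxBr mulmx1 !mulmxA mulmxV // mul1mx subrr.
pose T := col_mx V K; pose Q := row_mx (W *m G) (E *m K').
have TQ : T *m Q = 1%:M.
  rewrite mul_col_row !mulmxA mulmxV // KW VE !mul0mx scalar_mx_block.
  by congr block_mx; rewrite mulmxBr mulmx1 !mulmxA KW !mul0mx subr0.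
have QT : Q *m T = 1%:M.
  have EK : E *m K' *m K = E by rewrite EE -[Y *m K *m K']mulmxA KK' mulmx1.
  by rewrite /Q mul_row_col EK /E addrC subrK.
exists l, m.+1, (\rank (kermx W)), B; split=> //.
  rewrite -ltnS -(addSn 0) -[X in (_ <= X)%N]addn1 addnC.
  have : (\rank (1%:M : 'M[F]_(m.+1 + \rank (kermx W))) <= n.+1)%N.
    by rewrite -TQ (leq_trans (mxrankM_maxl _ _)) // rank_leq_col.
  by rewrite mxrank1; lia.
exists Q, T; split=> //.
suff TA : block_mx (jordan_block m.+1 l) 0 0 B *m T = T *m A.
  by rewrite -mulmxA TA mulmxA QT mul1mx.
by rewrite mul_block_col mul_col_mx !mul0mx addr0 add0r VA KA.
Qed.

Lemma jordan_form_exists n (A : 'M[F]_n) : exists s, is_jordan_form A s.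
Proof.
elim/ltn_ind: n A => -[|n] IHn A.
  exists [::]; split=> //; rewrite -/(simmx _ _).
  by move: (jordan_mx _) => /=; rewrite big_ord0 => B; rewrite !flatmx0; apply: simmx_refl.
have [l [m [r [B [m0 ltr simA]]]]] := split_jordan_block A isT.
have [s [pos simB]] := IHn _ ltr B.
exists ((l, m) :: s); split; first by rewrite /= m0.
apply: simmx_trans simA _; apply: simmx_trans (simmx_sym (jordan_mx_cons (l, m) s)).
by apply: simmx_block; first apply: simmx_refl.
Qed.
End JordanExistence.

(** * From the symmetric Jordan form to an invariant form *)

Section Pairing.

(** Induction on a subset A of T that is symmetric for the counting conditions:
    remove one element of a self-paired colour, or two elements with opposite
    colours.  Used with c listing the Jordan blocks, neg the change of sign of
    the eigenvalue, and self the nilpotent blocks of even size, which carry an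
    invariant symplectic form on their own. *)
Lemma exists_pairing (T : finType) (C : eqType) (c : T -> C) (neg : C -> C)
    (self : pred C) :
  involutive neg ->
  (forall v, self v -> neg v = v) ->
  (forall v, #|[set x | c x == v]| = #|[set x | c x == neg v]|) ->
  (forall v, ~~ self v -> neg v = v -> ~~ odd #|[set x | c x == v]|) ->
  exists2 s : T -> T, involutive s &
    (forall x, c (s x) = neg (c x)) /\ (forall x, s x = x -> self (c x)).
Proof.
move=> negK self_neg eqc evenc.
suff [s [sA cs sx]] : exists s : T -> T, [/\ {in [set: T], forall x, s (s x) = x},
    {in [set: T], forall x, c (s x) = neg (c x)} &
    {in [set: T], forall x, s x = x -> self (c x)}].
  by exists s => [x|]; last split=> x; [apply: sA|apply: cs|apply: sx]; rewrite inE.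
have {eqc} : forall v, #|[set x in [set: T] | c x == v]| = #|[set x in [set: T] | c x == neg v]|.
  by move=> v; under eq_finset do rewrite inE /=; rewrite eqc; apply: eq_card => x; rewrite !inE.
have {evenc} : forall v, ~~ self v -> neg v = v -> ~~ odd #|[set x in [set: T] | c x == v]|.
  by move=> v sv nv; under eq_finset do rewrite inE /=; apply: evenc.
have [k] := ubnP #|[set: T]|.
suff IH : forall A : {set T}, (#|A| < k)%N ->
    (forall v, ~~ self v -> neg v = v -> ~~ odd #|[set x in A | c x == v]|) ->
    (forall v, #|[set x in A | c x == v]| = #|[set x in A | c x == neg v]|) ->
  exists s : T -> T, [/\ {in A, forall x, s x \in A /\ s (s x) = x},
    {in A, forall x, c (s x) = neg (c x)} & {in A, forall x, s x = x -> self (c x)}].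
  move=> ltk ev eq; have [s [s1 s2 s3]] := IH _ ltk ev eq; exists s; split=> // x xT.
  by have [] := s1 x xT.
elim: k => // k IHk A; rewrite ltnS => leA evenA eqA.
have [->|[x xA]] := set_0Vmem A; first by exists id; split=> x; rewrite inE.
have [selfx|nselfx] := boolP (self (c x)).
  have cardD v : #|[set y in A | c y == v]| =
      ((c x == v) + #|[set y in A :\ x | c y == v]|)%N.
    rewrite (cardsD1 x) !inE xA /=; congr (_ + _)%N.
    by apply: eq_card => y; rewrite !inE andbA.
  have [|v sv nv|v|s [sA cs ss]] := IHk (A :\ x).
  - by apply: leq_trans leA; rewrite [X in (_ < X)%N](cardsD1 x) xA.
  - have := evenA v sv nv; rewrite cardD; case: eqP => // cx.
    by rewrite cx (negbTE sv) in selfx.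
  - have := eqA v; rewrite !cardD => /eqP.
    have -> : (c x == neg v) = (c x == v).
      by rewrite -[RHS](inj_eq (can_inj negK)) (self_neg _ selfx).
    by rewrite eqn_add2l => /eqP.
  exists (fun y => if y == x then x else s y); split=> y yA.
  - case: eqVneq => [->|yx]; first by rewrite eqxx.
    have [|] := sA y; first by rewrite !inE yx.
    by rewrite !inE => /andP [/negbTE -> ->].
  - by case: eqVneq => [->|yx]; [rewrite self_neg | rewrite cs // !inE yx].
  - by case: eqVneq => [->|yx] //; apply: ss; rewrite !inE yx.
have [y yx /andP [yA /eqP cy]] : exists2 y, y != x & (y \in A) && (c y == neg (c x)).
  have : (0 < #|[set y in A | c y == neg (c x)] :\ x|)%N.
    have := esym (eqA (c x)); have := evenA (c x) nselfx.
    rewrite (cardsD1 x) (cardsD1 x [set y in A | c y == neg (c x)]) !inE xA eqxx /=.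
    rewrite [c x == _]eq_sym; case: eqP => [E /(_ E) /= odd1 _|_ _ /=]; last by rewrite add0n => ->.
    by rewrite E; case: (#|_|) odd1.
  by rewrite card_gt0 => /set0Pn [y]; rewrite !inE => /andP [yx yA]; exists y.
have cardD v : #|[set z in A | c z == v]| =
    ((c x == v) + ((c y == v) + #|[set z in A :\ x :\ y | c z == v]|))%N.
  rewrite (cardsD1 x) !inE xA /= (cardsD1 y) !inE yx yA /=; congr (_ + (_ + _))%N.
  by apply: eq_card => z; rewrite !inE !andbA.
have negcx v : (c x == neg v) = (c y == v) by rewrite cy -(inj_eq (can_inj negK)) negK.
have negcy v : (c y == neg v) = (c x == v) by rewrite cy (inj_eq (can_inj negK)).
have [|v sv nv|v|s [sA cs ss]] := IHk (A :\ x :\ y).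
- apply: leq_trans leA; rewrite [X in (_ < X)%N](cardsD1 x) xA ltnS.
  exact/subset_leq_card/subsetDl.
- by have := evenA v sv nv; rewrite cardD -{1}nv negcx addnA addnn oddD odd_double.
- have := eqA v; rewrite !cardD negcx negcy addnCA => /eqP.
  by rewrite !eqn_add2l => /eqP.
exists (fun z => if z == x then y else if z == y then x else s z); split=> z zA.
- case: eqVneq => [->|zx]; first by rewrite (negbTE yx) eqxx.
  case: eqVneq => [->|zy]; first by rewrite eqxx.
  have [|] := sA z; first by rewrite !inE zx zy.
  by rewrite !inE => /and3P [/negbTE -> /negbTE -> ->].
- case: eqVneq => [->|zx]; first by [].
  case: eqVneq => [->|zy]; first by rewrite cy negK.
  by apply: cs; rewrite !inE zx zy.
- case: eqVneq => [->|zx]; first by move=> yE; rewrite yE eqxx in yx.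
  case: eqVneq => [->|zy]; first by move=> yE; rewrite yE eqxx in yx.
  by apply: ss; rewrite !inE zx zy.
Qed.
End Pairing.

Section JordanSymplectic.
Context {F : fieldType} (char2 : (2%:R : F) != 0).

(** The antidiagonal matrix with alternating signs, up to scale the form that
    makes the blocks for l and -l dual to each other. *)
Definition alt_mx m n : 'M[F]_(m, n) := \matrix_(a < m, b < n) ((a + b.+1 == m)%N%:R * (-1) ^+ a).

Lemma alt_mx_jordan m n l : m = n ->
  jordan_block m l *m alt_mx m n + alt_mx m n *m (jordan_block n (- l))^T = 0.
Proof.
move=> <- {n}; rewrite -[X in _ + X]trmxK trmx_mul trmxK.
pose f a b : F := (a + b.+1 == m)%N%:R * (-1) ^+ a.
pose f' b a : F := (a + b.+1 == m)%N%:R * (-1) ^+ a.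
apply/matrixP => a b; rewrite [LHS]mxE [X in _ + X]mxE (mul_jordan_block _ (f := fun a b => f a b)).
- rewrite (mul_jordan_block _ (f := fun b a => f' b a)) => [|? ?|?]; rewrite ?mxE //.
    rewrite /f /f' addSnnS exprS; ring.
  by rewrite /f' (_ : (_ == _)%N = false) ?mul0r //; lia.
- by move=> *; rewrite mxE.
- by move=> c; rewrite /f (_ : (_ == _)%N = false) ?mul0r //; lia.
Qed.

(** The form is skew-symmetric for even m and symmetric for odd m, which is why
    nilpotent blocks of odd size have to be paired. *)
Lemma tr_alt_mx m n : m = n -> (alt_mx m n)^T = - (-1) ^+ m *: alt_mx n m.
Proof.
move=> <- {n}; apply/matrixP => a b; rewrite !mxE addnS addnC -addnS.
case: eqP => [E|]; last by rewrite !mul0r mulr0.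
have -> : (-1) ^+ m = (-1) ^+ (a + b.+1) :> F by rewrite E.
rewrite !mul1r addnS exprS exprD -[_ ^+ a]signr_odd.
by case: (odd a); rewrite !(expr0, expr1); ring.
Qed.

Lemma alt_mx_sqr m n : m = n -> alt_mx m n *m alt_mx n m = (- (-1) ^+ m)%:M.
Proof.
move=> <- {n}; apply/matrixP => a b; rewrite !mxE.
rewrite (bigD1 (rev_ord a)) //= big1 ?addr0 => [|c ca]; last first.
  rewrite !mxE (_ : (a + c.+1 == m)%N = false) ?mul0r //.
  apply/negbTE; apply: contra ca => /eqP E; rewrite -val_eqE /=.
  by apply/eqP; have := ltn_ord a; lia.
have aE : (a + (rev_ord a).+1 = m)%N by rewrite /=; have := ltn_ord a; lia.
rewrite !mxE aE eqxx mul1r.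
have -> : (rev_ord a + b.+1 == m)%N = (a == b).
  by rewrite -val_eqE /=; have := ltn_ord a; lia.
case: eqP => _; rewrite ?mulr0n ?mul0r ?mulr0 // mul1r mulr1n.
have -> : (-1) ^+ m = (-1) ^+ (a + (rev_ord a).+1) :> F by rewrite aE.
by rewrite addnS exprS exprD; ring.
Qed.

Lemma jordan_sp_mx (s : seq (F * nat)) :
  (forall (k : nat) (l : F), l != 0 -> count_mem (l, k) s = count_mem (- l, k) s) ->
  (forall k : nat, ~~ odd (count_mem (0, k.*2.+1) s)) ->
  exists S, sp_mx (jordan_mx s) S.
Proof.
move=> sym ev; pose b (i : 'I_(size s)) := nth (0, 0%N) s i.
pose neg (v : F * nat) := (- v.1, v.2).
pose self (v : F * nat) := (v.1 == 0) && ~~ odd v.2.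
have cardE v : #|[set i | b i == v]| = count_mem v s.
  rewrite cardsE -sum1_card -sum1_count (big_nth (0, 0%N)) big_mkord.
  exact: eq_bigl.
have negK : involutive neg by case=> l k; rewrite /neg opprK.
have [||v|[l k]|sg sgK [bsg self_sg]] := @exists_pairing _ _ b neg self.
- exact: negK.
- by case=> l k /andP [/eqP /= -> _]; rewrite /neg oppr0.
- rewrite !cardE; case: v => l k; have [->|] := eqVneq l 0; last exact: sym.
  by rewrite /neg /= oppr0.
- rewrite cardE /self /neg /= => selfl [] /eqP; rewrite -subr_eq0 -opprD oppr_eq0.
  rewrite -mulr2n -mulr_natl mulf_eq0 (negbTE char2) /= => /eqP l0.
  rewrite {}l0 eqxx /= negbK in selfl *.
  by rewrite -(odd_double_half k) selfl; apply: ev.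
have bsg1 i : (b (sg i)).1 = - (b i).1 by rewrite bsg.
have bsg2 i : (b (sg i)).2 = (b i).2 by rewrite bsg.
(* The two off-diagonal blocks of a pair are minus the transpose of each other,
   so one of them gets the sign by which the transposition differs. *)
pose c (i : 'I_(size s)) : F := if (i <= sg i)%N then 1 else (-1) ^+ (b i).2.
have csg i : c (sg i) * c i = (-1) ^+ (b i).2.
  rewrite /c sgK bsg2; have [sgi|] := eqVneq (sg i) i.
    have /andP [_ /negbTE ev2] := self_sg i sgi.
    by rewrite sgi leqnn mulr1 -signr_odd ev2.
  rewrite -val_eqE /= => ne; case: (ltngtP (sg i) i) ne => // _ _.
    by rewrite mul1r.
  by rewrite mulr1.
pose S := \mxblock_(i, j) (if j == sg i then c i *: alt_mx (b i).2 (b j).2 else 0).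
have SS : S *m S = - 1%:M.
  rewrite mul_mxblock -mxdiagZ -mxdiagN /mxdiag; apply: eq_mxblock => i k.
  rewrite (bigD1 (sg i)) //= eqxx big1 ?addr0 => [|j /negbTE ->]; last by rewrite mul0mx.
  rewrite sgK eq_sym; case: eqVneq => [<-|]; last by rewrite mulmx0.
  rewrite conform_mx_id -scalemxAl -scalemxAr scalerA alt_mx_sqr ?bsg2 //.
  by rewrite mulrC csg scale_scalar_mx mulrN -signr_odd -expr2 sqrr_sign raddfN.
exists S; split.
- rewrite tr_mxblock /S -mxblockN; apply: eq_mxblock => i j.
  have -> : (i == sg j) = (j == sg i) by rewrite -(inj_eq (can_inj sgK)) sgK eq_sym.
  case: eqP => [->|]; last by rewrite trmx0 oppr0.
  rewrite linearZ /= tr_alt_mx ?bsg2 // scalerA -scaleNr; congr (_ *: _).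
  have := csg i; rewrite mulrN => <-; congr (- _).
  rewrite mulrA -expr2 /c sgK bsg2; case: ifP; rewrite ?expr1n ?mul1r //.
  by rewrite -signr_odd sqrr_sign mul1r.
- have : S *m (- S) = 1%:M by rewrite mulmxN SS opprK.
  by case/mulmx1_unit.
- rewrite tr_mxdiag mul_mxdiag_mxblock mul_mxblock_mxdiag -mxblockD -[RHS]mxblock0.
  apply: eq_mxblock => i j; case: eqP => [->|]; last by rewrite mulmx0 mul0mx addr0.
  rewrite -scalemxAl -scalemxAr -scalerDr.
  by rewrite -/(b i) -/(b (sg i)) bsg1 alt_mx_jordan ?scaler0 // bsg2.
Qed.
End JordanSymplectic.

(** * The Jordan criterion over the real numbers *)

Section RealDescent.
Context {R : realType}.
Local Notation toC := (real_complex R).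
Local Notation cplx := (map_mx toC).

Lemma char2_C : (2%:R : complex R) != 0.
Proof. by rewrite pnatr_eq0. Qed.

Lemma complex_mx_eq0 n m (X Y : 'M[R]_(n, m)) :
  (cplx X) + 'i%C *: (cplx Y) = 0 -> X = 0 /\ Y = 0.
Proof.
move=> /matrixP E; split; apply/matrixP => i j; have := E i j; rewrite !mxE.
  by move/(congr1 (@complex.Re R)); simpc => /=; rewrite ?(mul0r, mulr0, subr0, addr0, oppr0).
by move/(congr1 (@complex.Im R)); simpc => /=; rewrite ?(mul0r, mulr0, subr0, addr0, add0r, mul1r).
Qed.

Lemma poly_nonroot (p : {poly R}) : p != 0 -> exists t, p.[t] != 0.
Proof.
move=> p0; pose rs : seq R := [seq i%:R | i <- iota 0 (size p)].
have : ~~ all (root p) rs.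
  apply/negP => /(max_poly_roots p0) lt; have := lt _.
  rewrite map_inj_uniq ?iota_uniq; last by move=> i j /eqP; rewrite eqr_nat => /eqP.
  by rewrite size_map size_iota ltnn => /(_ isT).
by case/allPn => t _ pt; exists t.
Qed.

(** If S1 and S2 are the real and imaginary parts of S, every S1 + t S2 is skew
    and invariant.  Its determinant is a polynomial in t that does not vanish at
    t = i, hence not at some real t. *)
Lemma sp_mx_descent n (A : 'M[R]_n) (S : 'M[complex R]_n) :
  sp_mx (cplx A) S -> exists T : 'M[R]_n, sp_mx A T.
Proof.
case=> skS uS AS.
pose S1 := map_mx (@complex.Re R) S; pose S2 := map_mx (@complex.Im R) S.
have SE : S = (cplx S1) + 'i%C *: (cplx S2).
  by apply/matrixP => i j; rewrite !mxE; case: (S i j) => a b; simpc.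
have [sk1 sk2] : S1^T + S1 = 0 /\ S2^T + S2 = 0.
  apply: complex_mx_eq0; rewrite !map_mxD -!map_trmx scalerDr addrACA -SE.
  by rewrite -linearZ -linearD /= -SE skS addNr.
have [A1 A2] : A *m S1 + S1 *m A^T = 0 /\ A *m S2 + S2 *m A^T = 0.
  apply: complex_mx_eq0; rewrite !map_mxD !map_mxM -!map_trmx scalerDr addrACA.
  by rewrite scalemxAr scalemxAl -mulmxDr -mulmxDl -SE.
pose M : 'M[{poly R}]_n := map_mx polyC S1 + 'X *: map_mx polyC S2.
have MC : map_mx (horner_eval 'i%C \o map_poly toC) M = S.
  apply/matrixP => i j; rewrite SE !mxE rmorphD rmorphM /= /horner_eval.
  by rewrite !map_polyC map_polyX hornerX !hornerC.
have M0 : \det M != 0.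
  apply: contraTneq uS => M0.
  by rewrite unitmxE -MC det_map_mx M0 rmorph0 unitr0.
have [t Mt] := poly_nonroot M0.
have Mt' : map_mx (horner_eval t) M = S1 + t *: S2.
  by apply/matrixP => i j; rewrite !mxE /horner_eval hornerD hornerM hornerX !hornerC.
exists (S1 + t *: S2); split.
- apply/eqP; rewrite -addr_eq0 linearD linearZ /= addrACA -scalerDr sk1 sk2.
  by rewrite scaler0 addr0.
- by rewrite unitmxE unitfE -Mt' det_map_mx.
- rewrite mulmxDr mulmxDl -scalemxAl -scalemxAr addrACA -scalerDr A1 A2.
  by rewrite scaler0 addr0.
Qed.

Lemma sp_mx_jordan n (A : 'M[R]_n) :
  (exists S, sp_mx A S) <->
  exists2 s, is_jordan_form (cplx A) s &
    (forall (k : nat) (l : complex R), l != 0 ->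
       count_mem (l, k) s = count_mem (- l, k) s) /\
    (forall k : nat, (0 < k)%N -> ~~ odd (count_mem (0, (2 * k).-1) s)).
Proof.
split=> [[S [skS uS AS]]|[s [_ [P [Q [PQ QP AE]]]] [sym ev]]].
  have [s jA] := jordan_form_exists (cplx A).
  have spC : sp_mx (cplx A) (cplx S).
    split; first by rewrite map_trmx skS map_mxN.
      by rewrite map_unitmx.
    by rewrite map_trmx -!map_mxM -map_mxD AS map_mx0.
  have [sym ev] := sp_jordan_count char2_C spC jA.
  exists s => //; split=> [k l _|[//|k] _]; first exact: sym.
  by rewrite mul2n doubleS; apply: ev.
have ev' k : ~~ odd (count_mem (0, k.*2.+1) s) by have := ev k.+1 isT; rewrite mul2n doubleS.
have [S [skS uS JS]] := jordan_sp_mx char2_C sym ev'.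
apply: (@sp_mx_descent _ _ (P *m S *m P^T)); split.
- by rewrite !trmx_mul trmxK skS mulNmx mulmxN mulmxA.
- have : (P *m S *m P^T) *m (Q^T *m invmx S *m Q) = 1%:M.
    rewrite !mulmxA -(mulmxA _ P^T) -trmx_mul QP trmx1 mulmx1 -(mulmxA P) mulmxV //.
    by rewrite mulmx1.
  by case/mulmx1_unit.
- rewrite AE !trmx_mul !mulmxA -(mulmxA _ Q P) QP mulmx1 -(mulmxA _ P^T Q^T) -trmx_mul QP.
  by rewrite trmx1 mulmx1 -mulmxDl -!(mulmxA P) -mulmxDr JS mulmx0 mul0mx.
Qed.
End RealDescent.

(** * Alternating forms *)

Section Multilinear.
Context {R : realType} {V : vectType R}.

Lemma form_upd_sum k (a : kform V k) x i (J : finType) (c : J -> R) (w : J -> V) :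
  is_form a ->
  a (upd x i (\sum_j c j *: w j)) = \sum_j c j * a (upd x i (w j)).
Proof.
case=> lin _.
have a0 : a (upd x i 0) = 0.
  by have := lin x i (-1) 0 0; rewrite scaler0 addr0 mulN1r addNr.
elim: (index_enum J) => [|j s IHs]; first by rewrite !big_nil.
by rewrite !big_cons lin IHs.
Qed.

Lemma form_expand k (a : kform V k) (J : finType) (c : 'I_k -> J -> R) (w : J -> V) (j0 : J) :
  is_form a ->
  a [ffun l => \sum_j c l j *: w j] =
  \sum_(I : {ffun 'I_k -> J}) \prod_l c l (I l) * a [ffun l => w (I l)].
Proof.
move=> fa.
(* Expand the arguments in the slots of A only; induction on A. *)
have part : forall (A : {set 'I_k}) (f : {ffun 'I_k -> J}),
    a [ffun l => if l \in A then \sum_j c l j *: w j else w (f l)] =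
    \sum_(I : {ffun 'I_k -> J} | [forall (l | l \notin A), I l == f l])
      \prod_(l in A) c l (I l) * a [ffun l => w (I l)].
  move=> A; have [m] := ubnP #|A|; elim: m A => // m IHm A ltA f.
  have [->|[i iA]] := set_0Vmem A.
    rewrite (big_pred1 f) => [|I].
      by rewrite big_set0 mul1r; congr a; apply/ffunP => l; rewrite !ffunE inE.
    apply/forall_inP/eqP => [E|->] //; apply/ffunP => l; apply/eqP/E.
    by rewrite inE.
  have -> : [ffun l => if l \in A then \sum_j c l j *: w j else w (f l)] =
      upd [ffun l => if l \in A :\ i then \sum_j c l j *: w j else w (f l)] i
        (\sum_j c i j *: w j).
    by apply/ffunP => l; rewrite !ffunE !inE; case: eqVneq => [->|//]; rewrite iA.
  rewrite form_upd_sum // (partition_big (fun I : {ffun _} => I i) predT) //=.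
  apply: eq_bigr => j _; pose g := [ffun l => if l == i then j else f l].
  have -> : upd [ffun l => if l \in A :\ i then \sum_j c l j *: w j else w (f l)] i (w j)
      = [ffun l => if l \in A :\ i then \sum_j c l j *: w j else w (g l)].
    by apply/ffunP => l; rewrite !ffunE !inE; case: eqVneq.
  rewrite IHm; last first.
    by move: ltA; rewrite (cardsD1 i) iA.
  rewrite big_distrr /=; apply: eq_big => [I|I /forall_inP E].
    apply/forall_inP/andP => [E|[/forall_inP E /eqP Ii] l].
      split; last by have := E i; rewrite !inE eqxx ffunE eqxx; apply.
      apply/forall_inP => l lA; have := E l; rewrite !inE (negbTE lA) andbF ffunE /=.
      by case: (eqVneq l i) lA => [->|_ _]; [rewrite iA | move/(_ isT)].
    rewrite !inE ffunE negb_and negbK; case: eqVneq => [-> _|_ /= lA].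
      by rewrite Ii.
    exact: E.
  rewrite [in RHS](big_setD1 i) //= -mulrA; congr (_ * _).
  by have := E i; rewrite !inE eqxx ffunE eqxx => /(_ isT) /eqP ->.
have := part setT [ffun=> j0].
rewrite (_ : [ffun l => if l \in _ then _ else _] = [ffun l => \sum_j c l j *: w j]).
  move=> ->; apply: eq_big => [I|I _].
    by apply/forall_inP => l; rewrite inE.
  by congr (_ * _); apply: eq_bigl => l; rewrite inE.
by apply/ffunP => l; rewrite !ffunE inE.
Qed.

Definition fcomp m k (x : {ffun 'I_k -> V}) (s : 'I_m -> 'I_k) : {ffun 'I_m -> V} :=
  [ffun i => x (s i)].

Lemma form_tperm k (a : kform V k) x i j : is_form a -> i != j ->
  a (fcomp x (tperm i j)) = - a x.
Proof.
case=> lin alt ij.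
have add y i' v w : a (upd y i' (v + w)) = a (upd y i' v) + a (upd y i' w).
  by rewrite -[v]scale1r lin mul1r scale1r.
have alt2 v : a (upd (upd x i v) j v) = 0.
  by apply: (alt _ i j) => //; rewrite !ffunE !eqxx (negbTE ij).
have updC v w : upd (upd x i v) j w = upd (upd x j w) i v.
  apply/ffunP => l; rewrite !ffunE; case: (eqVneq l j) => // ->.
  by rewrite eq_sym (negbTE ij).
have := alt2 (x i + x j); rewrite add !(updC (x i + x j)) !add -!updC !alt2 add0r addr0.
move=> /eqP; rewrite addrC addr_eq0 => /eqP E.
have -> : fcomp x (tperm i j) = upd (upd x i (x j)) j (x i).
  by apply/ffunP => l; rewrite !ffunE; case: tpermP => [->|->|/eqP/negbTE-> /eqP/negbTE->];
    rewrite ?eqxx ?(negbTE ij).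
rewrite -[LHS]opprK -E; congr (- a _); apply/ffunP => l; rewrite !ffunE.
by case: eqVneq => [->|_] //; case: eqVneq => [->|].
Qed.

Lemma form_perm k (a : kform V k) x (s : 'S_k) : is_form a ->
  a (fcomp x s) = (-1) ^+ s * a x.
Proof.
move=> fa; have [ts -> dts] := prod_tpermP s.
elim: ts dts x => [_|t ts IHts /= /andP [dt dts]] x.
  rewrite big_nil odd_perm1 mul1r; congr a.
  by apply/ffunP => l; rewrite ffunE perm1.
rewrite big_cons odd_mul_tperm dt signr_addb -mulrA -IHts // mulN1r.
rewrite -(form_tperm _ fa dt); congr a.
by apply/ffunP => l; rewrite !ffunE permM.
Qed.
End Multilinear.

(** * Laplace expansion *)

Section Laplace.
Context {F : comNzRingType}.

Lemma sum_perm_fun p q (s : 'S_p) (t : 'S_q) :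
  injective (fun k => match split k with
                      | inl i => lshift q (s i) | inr j => rshift p (t j) end).
Proof.
move=> k l; case: (split_ordP k) => i ->; case: (split_ordP l) => j -> /=;
  move/eqP; rewrite ?eq_shift //= => /eqP /perm_inj -> //.
Qed.

Definition sum_perm p q (s : 'S_p) (t : 'S_q) : 'S_(p + q) := perm (@sum_perm_fun p q s t).

Lemma sum_perml p q (s : 'S_p) (t : 'S_q) i : sum_perm s t (lshift q i) = lshift q (s i).
Proof. by rewrite permE -[lshift q i]/(unsplit (inl i)) unsplitK. Qed.

Lemma sum_permr p q (s : 'S_p) (t : 'S_q) i : sum_perm s t (rshift p i) = rshift p (t i).
Proof. by rewrite permE -[rshift p i]/(unsplit (inr i)) unsplitK. Qed.

Lemma sign_sum_perm p q (s : 'S_p) (t : 'S_q) :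
  (-1) ^+ sum_perm s t = (-1) ^+ s * (-1) ^+ t :> F.
Proof.
rewrite -!det_perm -(det_ublock _ 0); congr (\det _); apply/matrixP => i j.
case: (split_ordP i) => a ->; case: (split_ordP j) => b ->;
  rewrite ?(block_mxEul, block_mxEur, block_mxEdl, block_mxEdr) !mxE
    ?sum_perml ?sum_permr ?eq_shift //.
Qed.

(** With the determinant normalization of the wedge product, this is the
    multiplicativity of monomials.  Expanding both minors, each term of the sum
    over s is reindexed by the block permutation of its two factors, and every
    such reindexing gives the full determinant once. *)
Lemma laplace p q (A : 'M[F]_(p, p + q)) (B : 'M[F]_(q, p + q)) :
  \sum_(s : 'S_(p + q)) (-1) ^+ s *
    (\det (\matrix_(i, j) A i (s (lshift q j))) * \det (\matrix_(i, j) B i (s (rshift p j))))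
  = (p`! * q`!)%:R * \det (col_mx A B).
Proof.
have aux (x y z t u : F) : x * (y * z * (t * u)) = y * t * x * (z * u) by ring.
transitivity (\sum_(s : 'S_(p + q)) \sum_(a : 'S_p) \sum_(b : 'S_q)
   (-1) ^+ (sum_perm a b * s)%g * \prod_k col_mx A B k ((sum_perm a b * s)%g k)).
  apply: eq_bigr => s _; rewrite big_distrl big_distrr /=; apply: eq_bigr => a _.
  rewrite big_distrr big_distrr /=; apply: eq_bigr => b _.
  rewrite odd_permM signr_addb sign_sum_perm big_split_ord /=.
  under [X in _ = _ * (X * _)]eq_bigr do rewrite permM sum_perml col_mxEu.
  under [X in _ = _ * (_ * X)]eq_bigr do rewrite permM sum_permr col_mxEd.
  under eq_bigr do rewrite mxE.
  under [X in _ * (_ * (_ * X)) = _]eq_bigr do rewrite mxE.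
  exact: aux.
rewrite exchange_big /=.
transitivity (\sum_(a : 'S_p) \sum_(b : 'S_q) \det (col_mx A B)).
  apply: eq_bigr => a _; rewrite exchange_big /=; apply: eq_bigr => b _.
  by rewrite (reindex_inj (mulgI (sum_perm a b)^-1%g)) /=; apply: eq_bigr => s _; rewrite mulKVg.
by rewrite !sumr_const !card_Sn -mulrnA mulnC mulr_natl.
Qed.
End Laplace.

(** * Determinants of explicit matrices *)

Section ListDet.
(** Expansion along the first row, without ordinals, so that it reduces to an
    explicit polynomial for a concrete size. *)
Fixpoint detl (A : pzRingType) n (M : nat -> nat -> A) : A :=
  if n is n'.+1 then
    foldr (fun j s => (-1) ^+ j * M 0%N j * detl n' (fun a b => M a.+1 (bump j b)) + s)
      0 (iota 0 n)
  else 1.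

Lemma detlE (A : comPzRingType) n (M : nat -> nat -> A) :
  detl n M = \det (\matrix_(i < n, j < n) M i j).
Proof.
elim: n M => [|n IHn] M; first by rewrite det_mx00.
rewrite (expand_det_row _ ord0) /=.
transitivity (\sum_(0 <= j < n.+1)
    (-1) ^+ j * M 0%N j * detl n (fun a b => M a.+1 (bump j b))).
  by rewrite unlock /reducebig /index_iota subn0.
rewrite big_mkord; apply: eq_bigr => j _; rewrite /cofactor mxE IHn mulrA add0n [X in X * _]mulrC.
congr (_ * \det _); apply/matrixP => a b; rewrite !mxE; congr M.
Qed.

(** The determinant of a 0-1 matrix, skipping the zero entries: this makes the
    tables of monomials below computable in a short time. *)
Fixpoint dtab n (M : nat -> nat -> bool) : int :=
  if n is n'.+1 then
    foldr (fun j s => (if M 0%N j then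
        (if odd j then - dtab n' (fun a b => M a.+1 (bump j b))
         else dtab n' (fun a b => M a.+1 (bump j b))) else 0) + s)
      0 (iota 0 n)
  else 1.

Arguments dtab : simpl never.

Lemma dtabE (A : comPzRingType) n (M : nat -> nat -> bool) :
  (dtab n M)%:~R = detl n (fun a b => (M a b)%:R) :> A.
Proof.
elim: n M => // n IHn M.
suff fold r : (foldr (fun j s => (if M 0%N j then
        (if odd j then - dtab n (fun a b => M a.+1 (bump j b))
         else dtab n (fun a b => M a.+1 (bump j b))) else 0) + s) 0 r)%:~R =
    foldr (fun j s => (-1) ^+ j * (M 0%N j)%:R *
        detl n (fun a b => (M a.+1 (bump j b))%:R) + s) 0 r :> A.
  exact: fold (iota 0 n.+1).
elim: r => //= j r IHr; rewrite rmorphD /= IHr -IHn; congr (_ + _).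
case: (M 0%N j); rewrite ?mulr0 ?mul0r // mulr1 -signr_odd.
by case: odd; rewrite /= ?rmorphN ?expr1 ?mulN1r ?expr0 ?mul1r.
Qed.
End ListDet.

(** * Monomials in the dual basis *)

Section Coordinates.
Context {R : realType} {V : vectType R}.
Implicit Types (e : 7.-tuple V) (I J K : seq nat).

Definition crd e (i : nat) (x : V) : R := coord e (inord i) x.

(** The monomial of the dual forms with indices I, numbered from 0.  Indices may
    be repeated or unsorted. *)
Definition mono e I k : kform V k := fun x =>
  \det (\matrix_(a < k, b < k) crd e (nth 0%N I a) (x b)).

Lemma crdP e i (a : R) x y : crd e i (a *: x + y) = a * crd e i x + crd e i y.
Proof. by rewrite /crd linearP. Qed.

Lemma crd_is_linear e i : linear (crd e i : V -> R^o).
Proof. by move=> a x y; rewrite /crd linearP. Qed.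

HB.instance Definition _ e i := GRing.isLinear.Build R V R^o _ (crd e i) (crd_is_linear e i).

Lemma mono_form e I k : is_form (mono e I (k := k)).
Proof.
split=> [x i c y z|x i j ij xij]; rewrite /mono.
  rewrite -(det_tr (\matrix_(_, _) crd _ _ (upd _ _ (_ + _) _))).
  rewrite -(det_tr (\matrix_(_, _) crd _ _ (upd _ _ y _))).
  rewrite -(det_tr (\matrix_(_, _) crd _ _ (upd _ _ z _))) -[X in _ = _ + X]mul1r.
  apply: (determinant_multilinear (i0 := i)).
  - apply/rowP => j; rewrite !mxE !ffunE eqxx mul1r.
    by rewrite linearP.
  - by apply/matrixP => l j; rewrite !mxE !ffunE eq_sym (negbTE (neq_lift _ _)).
  - by apply/matrixP => l j; rewrite !mxE !ffunE eq_sym (negbTE (neq_lift _ _)).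
rewrite -det_tr; apply: (determinant_alternate ij) => l.
by rewrite !mxE xij.
Qed.

Lemma mono_cat e I J p q : size I = p ->
  wedge (mono e I (k := p)) (mono e J (k := q)) =1 mono e (I ++ J) (k := p + q).
Proof.
move=> sI x; rewrite /wedge /mono.
pose A := \matrix_(a < p, b < p + q) crd e (nth 0%N I a) (x b).
pose B := \matrix_(a < q, b < p + q) crd e (nth 0%N J a) (x b).
have -> : \matrix_(a < p + q, b < p + q) crd e (nth 0%N (I ++ J) a) (x b) = col_mx A B.
  apply/matrixP => a b; rewrite mxE; case: (split_ordP a) => c ->.
    by rewrite col_mxEu mxE nth_cat /= sI ltn_ord.
  by rewrite col_mxEd mxE nth_cat /= sI ltnNge leq_addr addKn.
apply: (mulfI (_ : (p`! * q`!)%:R != 0 :> R)); first by rewrite pnatr_eq0 muln_eq0 !gtn_eqF ?fact_gt0.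
rewrite mulVKf ?pnatr_eq0 ?muln_eq0 ?gtn_eqF ?fact_gt0 // -laplace.
by apply: eq_bigr => s _; congr (_ * _); congr (_ * _);
  congr (\det _); apply/matrixP => a b; rewrite !mxE ffunE.
Qed.

Lemma eq_wedge p q (a a' : kform V p) (b b' : kform V q) :
  a =1 a' -> b =1 b' -> wedge a b =1 wedge a' b'.
Proof.
move=> ea eb x; rewrite /wedge; congr (_ * _); apply: eq_bigr => s _.
by rewrite ea eb.
Qed.

Lemma wedge_suml p q (T : Type) (r : seq T) (c : T -> R) (a : T -> kform V p) (b : kform V q) :
  wedge (fun x => \sum_(t <- r) c t * a t x) b =1
  fun x => \sum_(t <- r) c t * wedge (a t) b x.
Proof.
move=> x; rewrite /wedge.
under eq_bigr do rewrite big_distrl big_distrr /=.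
rewrite exchange_big big_distrr /=; apply: eq_bigr => t _.
rewrite mulrCA; congr (_ * _); rewrite big_distrr /=; apply: eq_bigr => s _.
by rewrite -mulrA mulrCA.
Qed.

Lemma wedge_sumr p q (T : Type) (r : seq T) (c : T -> R) (a : kform V p) (b : T -> kform V q) :
  wedge a (fun x => \sum_(t <- r) c t * b t x) =1
  fun x => \sum_(t <- r) c t * wedge a (b t) x.
Proof.
move=> x; rewrite /wedge.
under eq_bigr do rewrite big_distrr big_distrr /=.
rewrite exchange_big big_distrr /=; apply: eq_bigr => t _.
rewrite mulrCA; congr (_ * _); rewrite big_distrr /=; apply: eq_bigr => s _.
have aux (y z u v : R) : y * (z * (u * v)) = u * (y * (z * v)) by ring.
exact: aux.
Qed.

(** A form with integral coefficients in the monomials is a list of pairs of a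
    coefficient and an index list.  Wedge and interior products then become
    computations on lists. *)
Definition form_of e k (L : seq (int * seq nat)) : kform V k := fun x =>
  \sum_(t <- L) t.1%:~R * mono e t.2 x.

Definition has_deg k (L : seq (int * seq nat)) := all (fun t => (size t.2 == k) && all (gtn 7) t.2) L.

Definition lwedge (L M : seq (int * seq nat)) :=
  [seq (t.1 * u.1, t.2 ++ u.2) | t <- L, u <- M].

Lemma form_of_wedge e p q L M : has_deg p L ->
  wedge (form_of e L (k := p)) (form_of e M (k := q)) =1 form_of e (lwedge L M) (k := p + q).
Proof.
move=> /allP dL x; rewrite wedge_suml /form_of big_allpairs_dep /=.
apply: eq_big_seq => t /dL /andP [/eqP st _]; rewrite wedge_sumr big_distrr /=.
by apply: eq_bigr => u _; rewrite mono_cat // rmorphM mulrA.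
Qed.

Definition del T a (K : seq T) := take a K ++ drop a.+1 K.

(** Interior product with the i-th basis vector: delete each occurrence of i and
    record the parity of its position. *)
Definition lcontract i (L : seq (int * seq nat)) :=
  [seq ((if odd ta.2 then - ta.1.1 else ta.1.1), del ta.2 ta.1.2) |
     ta <- [seq (t, a) | t <- L, a <- [seq a <- iota 0 (size t.2) | nth 0%N t.2 a == i]]].

Lemma nth_del T (x0 : T) a (K : seq T) b : (a < size K)%N ->
  nth x0 (del a K) b = nth x0 K (bump a b).
Proof.
move=> ltaK; rewrite /del nth_cat size_take ltaK /bump.
case: (ltnP b a) => ltab; first by rewrite nth_take.
by rewrite nth_drop addSn subnKC // add1n.
Qed.

Lemma contract_mono e v K k : size K = k.+1 ->
  contract v (mono e K (k := k.+1)) =1 fun x =>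
  \sum_(a < k.+1) (-1) ^+ a * crd e (nth 0%N K a) v * mono e (del a K) x.
Proof.
move=> sK x; rewrite /contract /mono (expand_det_col _ ord0).
apply: eq_bigr => a _; rewrite mxE ffunE unlift_none /= /cofactor addn0 mulrCA mulrA.
congr (_ * \det _); apply/matrixP => b c; rewrite !mxE ffunE liftK /= nth_del //.
by rewrite sK.
Qed.

Lemma contract_ev e v L k : has_deg k.+1 L ->
  contract v (form_of e L (k := k.+1)) =1 fun x =>
  \sum_(i < 7) crd e i v * form_of e (lcontract i L) x.
Proof.
move=> /allP dL x.
transitivity (\sum_(t <- L) t.1%:~R * contract v (mono e t.2 (k := k.+1)) x); first by [].
under [RHS]eq_bigr do rewrite /form_of big_map big_allpairs_dep big_distrr /=.
rewrite exchange_big /=; apply: eq_big_seq => t /dL /andP [/eqP st /allP lt7].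
rewrite contract_mono // big_distrr /=.
transitivity (\sum_(i < 7) \sum_(a <- iota 0 k.+1 | nth 0%N t.2 a == i)
   t.1%:~R * ((-1) ^+ a * crd e (nth 0%N t.2 a) v * mono e (del a t.2) x)).
  rewrite -(big_mkord xpredT (fun a : nat => t.1%:~R * ((-1) ^+ a *
     crd e (nth 0%N t.2 a) v * mono e (del a t.2) x))) /index_iota subn0.
  under [RHS]eq_bigr do rewrite big_mkcond; rewrite [RHS]exchange_big.
  apply: eq_big_seq => a; rewrite mem_iota add0n => /andP [_ lta].
  have lt : (nth 0%N t.2 a < 7)%N by apply: lt7; rewrite mem_nth ?st.
  rewrite (bigD1 (Ordinal lt)) //= eqxx big1 ?addr0 // => i.
  by rewrite -val_eqE eq_sym /= => /negbTE ->.
apply: eq_bigr => i _; rewrite big_distrr big_filter st /=.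
apply: eq_bigr => a /eqP ->; rewrite -signr_odd; case: (odd a).
  by rewrite expr1 rmorphN; ring.
by rewrite expr0; ring.
Qed.

(** The value of the monomial K on the basis vectors I 0, I 1, ... *)
Definition mono_coef k (K : seq nat) (I : nat -> nat) : int := dtab k (fun a b => nth 0%N K a == I b).

Arguments mono_coef : simpl never.

(** The coefficient of a form of top degree with respect to the volume
    monomial 0 1 2 3 4 5 6. *)
Definition lcoef_top (L : seq (int * seq nat)) : int :=
  foldr (fun t s => t.1 * mono_coef 7%N t.2 id + s) 0 L.

Lemma mono_top e K (x : {ffun 'I_7 -> V}) : all (gtn 7) K -> size K = 7%N ->
  mono e K x = (mono_coef 7%N K id)%:~R * mono e (iota 0%N 7%N) x.
Proof.
move=> /allP lt7 sK; rewrite /mono_coef dtabE detlE /mono -det_mulmx; congr (\det _).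
apply/matrixP => a b; rewrite !mxE.
have lt : (nth 0%N K a < 7)%N by apply: lt7; rewrite mem_nth ?sK.
rewrite (bigD1 (Ordinal lt)) // [X in _ = X * _ + _]mxE eqxx mul1r mxE nth_iota // add0n.
rewrite big1 ?addr0 // => i; rewrite -val_eqE eq_sym => /negbTE /= ne.
by rewrite mxE ne mul0r.
Qed.

Lemma form_of_top e L (x : {ffun 'I_7 -> V}) : has_deg 7%N L -> form_of e L x = (lcoef_top L)%:~R * mono e (iota 0%N 7%N) x.
Proof.
rewrite /form_of; elim: L => [|t L IHL]; first by rewrite big_nil mul0r.
move=> /andP [/andP [/eqP st lt7] dL]; rewrite big_cons IHL // mono_top //.
have -> : lcoef_top (t :: L) = t.1 * mono_coef 7%N t.2 id + lcoef_top L by [].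
have -> : (t.1 * mono_coef 7%N t.2 id + lcoef_top L)%:~R = t.1%:~R * (mono_coef 7%N t.2 id)%:~R + (lcoef_top L)%:~R :> R.
  by rewrite intrD intrM.
by rewrite mulrDl mulrA.
Qed.

Lemma crd_basis e i j : basis_of fullv e -> (i < 7)%N -> (j < 7)%N ->
  crd e i (nth 0 e j) = (i == j)%:R.
Proof.
move=> /basis_free fe li lj; have := coord_free (inord j) (inord i) fe.
by rewrite !inordK // /crd => ->; rewrite eq_sym -val_eqE /= !inordK.
Qed.

Lemma mono_top1 e : basis_of fullv e -> mono e (iota 0%N 7%N) [ffun i => tnth e i] = 1.
Proof.
move=> be; rewrite -[RHS](det1 R 7); congr (\det _); apply/matrixP => a b.
by rewrite !mxE ffunE nth_iota // add0n (tnth_nth 0) crd_basis.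
Qed.

Lemma crd_sum e x : basis_of fullv e -> x = \sum_(i < 7) crd e i x *: e`_i.
Proof.
move=> be; rewrite {1}(coord_basis be (memvf x)); apply: eq_bigr => i _.
by rewrite /crd inord_val.
Qed.

Lemma mono_basis e K k (I : 'I_k -> 'I_7) (I' : nat -> nat) : basis_of fullv e ->
  all (gtn 7) K -> (forall i : 'I_k, I' i = I i) ->
  mono e K [ffun l => e`_(I l)] = (mono_coef k K I')%:~R.
Proof.
move=> be lt7 II; rewrite /mono_coef dtabE detlE /mono; congr (\det _).
apply/matrixP => a b; rewrite !mxE ffunE crd_basis // ?II //.
by have [lt|ge] := ltnP a (size K); [apply: (allP lt7); rewrite mem_nth | rewrite nth_default].
Qed.

(** All index functions I are summed, not only the increasing ones; this avoids
    sorting, and each monomial is counted k! times. *)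
Lemma form_mono_expand e k (a : kform V k) x : basis_of fullv e -> is_form a ->
  a x = k`!%:R^-1 * \sum_(I : {ffun 'I_k -> 'I_7})
          a [ffun l => e`_(I l)] * mono e [seq val (I l) | l : 'I_k] x.
Proof.
move=> be fa; apply: (mulfI (_ : k`!%:R != 0 :> R)); first by rewrite pnatr_eq0 gtn_eqF ?fact_gt0.
rewrite mulVKf ?pnatr_eq0 ?gtn_eqF ?fact_gt0 //.
transitivity (\sum_(s : 'S_k) (-1) ^+ s * a (fcomp x s)).
  rewrite -card_Sn -sumr_const mulr_suml; apply: eq_bigr => s _.
  by rewrite form_perm // mulrA -signr_addb addbb mul1r.
transitivity (\sum_(s : 'S_k) (-1) ^+ s * \sum_(I : {ffun 'I_k -> 'I_7})
   \prod_l crd e (I l) (x (s l)) * a [ffun l => e`_(I l)]).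
  apply: eq_bigr => s _; rewrite -(@form_expand _ _ _ a _ (fun l (i : 'I_7) => crd e i (x (s l))) (fun i => e`_i) ord0) //.
  by congr (_ * a _); apply/ffunP => l; rewrite !ffunE -crd_sum.
under eq_bigr do rewrite big_distrr /=.
rewrite exchange_big /=; apply: eq_bigr => I _; rewrite [RHS]mulrC /mono big_distrl /=.
apply: eq_bigr => s _; rewrite -mulrA; congr (_ * (_ * _)).
apply: eq_bigr => l _; rewrite mxE; congr (crd e _ _).
by rewrite (nth_map l) ?size_enum_ord // nth_ord_enum.
Qed.
End Coordinates.

(** * The models, their metric and their dual 4-form *)

Section Structures.
Context {R : realType} {V : vectType R}.
Implicit Types (e : 7.-tuple V) (eps : bool).

(** The flag eps selects the split form; this is the only sign in which the two
    models and their dual forms differ. *)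
Definition model_eps eps : int := if eps then -1 else 1.

Definition philist eps : seq (int * seq nat) :=
  [:: (model_eps eps, [:: 0; 1; 6]%N); (model_eps eps, [:: 2; 3; 6]%N); (1, [:: 4; 5; 6]%N);
      (1, [:: 0; 2; 4]%N); (-1, [:: 0; 3; 5]%N); (-1, [:: 1; 2; 5]%N); (-1, [:: 1; 3; 4]%N)].

Definition starlist eps : seq (int * seq nat) :=
  [:: (model_eps eps, [:: 0; 1; 4; 5]%N); (model_eps eps, [:: 2; 3; 4; 5]%N); (1, [:: 0; 1; 2; 3]%N);
      (-1, [:: 1; 3; 5; 6]%N); (1, [:: 1; 2; 4; 6]%N); (1, [:: 0; 3; 4; 6]%N); (1, [:: 0; 2; 5; 6]%N)].

Definition model_sign eps (i : nat) : int := if (i < 4)%N then model_eps eps else 1.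

Definition model eps := if eps then G2star_model (R := R) (V := V) else G2_model.

Lemma dual1_mono e i : dual1 e i =1 mono e [:: i.-1] (k := 1).
Proof. by move=> x; rewrite /mono det_mx11 mxE. Qed.

Lemma dual3_mono e i j k : dual3 e i j k =1 mono e [:: i.-1; j.-1; k.-1] (k := 3).
Proof.
move=> x; rewrite /dual3.
rewrite (eq_wedge (eq_wedge (dual1_mono e i) (dual1_mono e j)) (dual1_mono e k)).
rewrite (@eq_wedge _ _ 2 1 _ (mono e [:: i.-1; j.-1] (k := 2)) _ (mono e [:: k.-1] (k := 1))) //; last first.
  by move=> y; rewrite (@mono_cat _ _ _ _ _ 1 1).
by rewrite (@mono_cat _ _ _ _ _ 2 1).
Qed.

Lemma model_form_of eps e : model eps e =1 form_of e (philist eps) (k := 3).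
Proof.
move=> x; rewrite /model /form_of !big_cons big_nil /=.
by case: eps; rewrite /G2_model /G2star_model !dual3_mono /= ?(mulN1r, mul1r, addr0, addrA) //.
Qed.

(** The metric formula on basis vectors: a table of 49 values. *)
Lemma philist_metric eps i j : (i < 7)%N -> (j < 7)%N ->
  lcoef_top (lwedge (lwedge (lcontract i (philist eps)) (lcontract j (philist eps))) (philist eps))
  = 6 * (model_sign eps i * (i == j)%:R).
Proof.
move=> li lj.
have check b : all (fun i => all (fun j =>
    lcoef_top (lwedge (lwedge (lcontract i (philist b)) (lcontract j (philist b))) (philist b))
    == 6 * (model_sign b i * (i == j)%:R)) (iota 0%N 7%N)) (iota 0%N 7%N) by case: b; vm_compute.
have /allP /(_ i) := check eps; rewrite mem_iota => /(_ li) /allP /(_ j).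
by rewrite mem_iota => /(_ lj) /eqP.
Qed.

Definition model_ip eps e (v w : V) : R := \sum_(i < 7) (model_sign eps i)%:~R * crd e i v * crd e i w.

Lemma model_metric eps e (phi : kform V 3) v w (x : {ffun 'I_7 -> V}) :
  phi =1 model eps e ->
  6^-1 * wedge (wedge (contract v phi) (contract w phi)) phi x =
  model_ip eps e v w * mono e (iota 0%N 7%N) x.
Proof.
move=> phiE; have {}phiE : phi =1 form_of e (philist eps) by move=> y; rewrite phiE model_form_of.
have conE u : contract u phi =1 fun y => \sum_(i < 7) crd e i u * form_of e (lcontract i (philist eps)) y.
  move=> y; rewrite -contract_ev; last by case: eps phiE.
  by rewrite /contract phiE.
rewrite (eq_wedge (eq_wedge (conE v) (conE w)) phiE).
pose W i j := wedge (wedge (form_of e (lcontract i (philist eps)) (k := 2))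
   (form_of e (lcontract j (philist eps)) (k := 2))) (form_of e (philist eps) (k := 3)).
transitivity (6^-1 * \sum_(i < 7) crd e i v * \sum_(j < 7) crd e j w * W i j x).
  congr (_ * _).
  pose A i := form_of e (lcontract i (philist eps)) (k := 2).
  transitivity (wedge (fun y => \sum_(i < 7) crd e i v *
      (fun z => \sum_(j < 7) crd e j w * wedge (A i) (A j) z) y) (form_of e (philist eps) (k := 3)) x).
    apply: eq_wedge => // y; rewrite wedge_suml; apply: eq_bigr => i _.
    by rewrite wedge_sumr.
  by rewrite wedge_suml; apply: eq_bigr => i _; rewrite wedge_suml.
rewrite /model_ip mulr_suml big_distrr /=; apply: eq_bigr => i _.
have degc (j : 'I_7) : has_deg 2%N (lcontract j (philist eps)).
  by case: eps W {phiE conE}; case: j => [[|[|[|[|[|[|[|//]]]]]]] ?].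
have WE (j : 'I_7) : W i j x = 6 * (model_sign eps i)%:~R * (i == j)%:R * mono e (iota 0%N 7%N) x.
  rewrite /W (eq_wedge (@form_of_wedge _ _ e 2 2 _ _ (degc i)) (frefl _)).
  rewrite (@form_of_wedge _ _ e 4 3); last first.
    by case: eps W {phiE conE degc}; case: i => [[|[|[|[|[|[|[|//]]]]]]] ?];
       case: j => [[|[|[|[|[|[|[|//]]]]]]] ?].
  rewrite form_of_top; last first.
    by case: eps W {phiE conE degc}; case: i => [[|[|[|[|[|[|[|//]]]]]]] ?];
       case: j => [[|[|[|[|[|[|[|//]]]]]]] ?].
  rewrite philist_metric // !intrM mulrA -val_eqE; by case: (_ == _).
rewrite (bigD1 i) //= WE eqxx big1 ?addr0 => [|j /negbTE ij].
  by rewrite mulr1; field.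
by rewrite WE eq_sym ij !(mulr0, mul0r).
Qed.

Lemma ip_is_bilinear eps e : bilinear_for
  (GRing.Scale.Law.clone _ _ *%R _) (GRing.Scale.Law.clone _ _ *%R _) (model_ip eps e).
Proof.
split=> u a x y; rewrite /= /model_ip mulr_sumr -big_split /=; apply: eq_bigr => i _.
  by rewrite crdP; ring.
by rewrite crdP; ring.
Qed.

HB.instance Definition _ eps e := bilinear_isBilinear.Build R V V R *%R *%R (model_ip eps e)
  (ip_is_bilinear eps e).

Lemma ip_is_hermitian eps e x y : model_ip eps e x y = (-1) ^+ false * idfun (model_ip eps e y x).
Proof. by rewrite mul1r /=; apply: eq_bigr => i _; ring. Qed.

HB.instance Definition _ eps e := isHermitianSesquilinear.Build R V false idfun (model_ip eps e)
  (ip_is_hermitian eps e).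

Lemma form_of_form e k L : is_form (form_of e L (k := k)).
Proof.
split=> [x i c y z|x i j ij xij].
  rewrite /form_of mulr_sumr -big_split /=; apply: eq_bigr => t _.
  by rewrite (mono_form e t.2 k).1; ring.
by rewrite /form_of big1 // => t _; rewrite ((mono_form e t.2 k).2 _ _ _ ij xij) mulr0.
Qed.

Lemma model_sign_sqr eps i : ((model_sign eps i)%:~R : R) * (model_sign eps i)%:~R = 1.
Proof.
by rewrite /model_sign /model_eps; case: eps; case: ifP => _; rewrite ?mulr1 // rmorphN mulrNN mulr1.
Qed.

(** The inner product of forms does not depend on the basis: if P is the change
    of coordinates from the reference basis to e, the Gram matrix is P S P^T with
    S the diagonal matrix of signs, so P^T times its inverse times P is S. *)
Lemma form_inner_basis eps e (g : V -> V -> R) k (a b : kform V k) :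
  basis_of fullv e -> g =2 model_ip eps e -> is_form a -> is_form b ->
  form_inner g a b = k`!%:R^-1 * \sum_(I : {ffun 'I_k -> 'I_7})
    (\prod_l (model_sign eps (I l))%:~R) * (a [ffun l => e`_(I l)] * b [ffun l => e`_(I l)]).
Proof.
move=> be gE fa fb; rewrite /form_inner; congr (_ * _).
set vb := vbasis fullv; have bvb : basis_of fullv vb by apply: vbasisP.
pose P := \matrix_(i < \dim {:V}, A < 7) crd e A vb`_i.
pose T := \matrix_(A < 7, i < \dim {:V}) coord vb i e`_A.
pose S : 'M[R]_7 := diag_mx (\row_A (model_sign eps A)%:~R).
have PT : P *m T = 1%:M.
  apply/matrixP => i j; rewrite !mxE.
  have := coord_free i j (basis_free bvb).
  rewrite {1}(crd_sum vb`_i be) linear_sum => <-.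
  by apply: eq_bigr => A _; rewrite linearZ !mxE.
have TP : T *m P = 1%:M.
  apply/matrixP => A B; rewrite !mxE.
  have := crd_basis be (ltn_ord B) (ltn_ord A).
  rewrite {1}(coord_basis bvb (memvf e`_A)) linear_sum val_eqE eq_sym => <-.
  by apply: eq_bigr => i _; rewrite linearZ !mxE.
have SS : S *m S = 1%:M.
  apply/matrixP => A B; rewrite mul_diag_mx !mxE mulrnAr.
  by case: eqVneq => [->|_]; rewrite ?model_sign_sqr.
have GE : gram g = P *m S *m P^T.
  apply/matrixP => i j; rewrite mul_mx_diag !mxE gE /model_ip.
  by apply: eq_bigr => A _; rewrite !mxE; ring.
have GI : invmx (gram g) = T^T *m S *m T.
  have GB : gram g *m (T^T *m S *m T) = 1%:M.
    rewrite GE !mulmxA -(mulmxA _ P^T) -trmx_mul TP trmx1 mulmx1 -(mulmxA P) SS.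
    by rewrite mulmx1 PT.
  have [uG _] := mulmx1_unit GB.
  by rewrite -[LHS]mulmx1 -GB mulmxA mulVmx // mul1mx.
have KE : P^T *m invmx (gram g) *m P = S.
  rewrite GI !mulmxA -trmx_mul TP trmx1 mul1mx -mulmxA TP mulmx1 //.
have expd (c : kform V k) (I : {ffun 'I_k -> 'I_(\dim {:V})}) : is_form c ->
    c [ffun l => vb`_(I l)] = \sum_(A : {ffun 'I_k -> 'I_7})
      \prod_l P (I l) (A l) * c [ffun l => e`_(A l)].
  move=> fc; rewrite -(@form_expand _ _ _ c _ (fun l A => P (I l) A) (fun A => e`_A) ord0) //.
  congr c; apply/ffunP => l; rewrite !ffunE [LHS](crd_sum _ be).
  by apply: eq_bigr => A _; rewrite mxE.
transitivity (\sum_(A : {ffun 'I_k -> 'I_7}) \sum_(B : {ffun 'I_k -> 'I_7})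
  (\prod_l S (A l) (B l)) * (a [ffun l => e`_(A l)] * b [ffun l => e`_(B l)])).
  transitivity (\sum_(I : {ffun 'I_k -> 'I_(\dim {:V})})
    \sum_(J : {ffun 'I_k -> 'I_(\dim {:V})})
    \sum_(A : {ffun 'I_k -> 'I_7}) \sum_(B : {ffun 'I_k -> 'I_7})
     (\prod_l (P (I l) (A l) * invmx (gram g) (I l) (J l) * P (J l) (B l))) *
     (a [ffun l => e`_(A l)] * b [ffun l => e`_(B l)])).
    apply: eq_bigr => I _; apply: eq_bigr => J _; rewrite (expd a I fa) (expd b J fb).
    rewrite -mulrA mulr_suml mulr_sumr; apply: eq_bigr => A _.
    rewrite !mulr_sumr; apply: eq_bigr => B _; rewrite !big_split /=.
    by set x := \prod_(i < k) _; set y := \prod_(i < k) _; set z := \prod_(i < k) _; ring.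
  under eq_bigr do rewrite exchange_big /=.
  rewrite exchange_big /=; apply: eq_bigr => A _.
  under eq_bigr do rewrite exchange_big /=.
  rewrite exchange_big /=; apply: eq_bigr => B _.
  under eq_bigr do rewrite -mulr_suml.
  rewrite -mulr_suml; congr (_ * _).
  have -> : \prod_l S (A l) (B l) =
      \prod_l \sum_i \sum_j P i (A l) * invmx (gram g) i j * P j (B l).
    apply: eq_bigr => l _; rewrite -KE !mxE exchange_big /=; apply: eq_bigr => j _.
    by rewrite !mxE big_distrl /=; apply: eq_bigr => i _; rewrite [P^T _ _]mxE.
  by rewrite bigA_distr_bigA; apply: eq_bigr => I _; rewrite bigA_distr_bigA.
apply: eq_bigr => A _; rewrite (bigD1 A) //= [X in _ + X]big1 ?addr0 => [|B BA].
  by congr (_ * _); apply: eq_bigr => l _; rewrite !mxE eqxx mulr1n.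
have [l Al] : exists l, A l != B l.
  apply/existsP; rewrite -negb_forall; apply: contra BA => /forallP E.
  by apply/eqP/ffunP => l; rewrite (eqP (E l)).
by rewrite (bigD1 l) //= !mxE (negbTE Al) mulr0n !mul0r.
Qed.

Definition lcoef k (L : seq (int * seq nat)) (I : nat -> nat) : int :=
  foldr (fun t s => t.1 * mono_coef k t.2 I + s) 0 L.

Lemma form_of_basis e k L (I : {ffun 'I_k -> 'I_7}) (I' : nat -> nat) : basis_of fullv e ->
  all (fun t => all (gtn 7%N) t.2) L -> (forall i : 'I_k, I' i = I i) ->
  form_of e L [ffun l => e`_(I l)] = (lcoef k L I')%:~R.
Proof.
move=> be lt7 II; rewrite /form_of; elim: L lt7 => [|t L IHL] /=; first by rewrite big_nil.
case/andP=> lt7 ltL; rewrite big_cons IHL // (mono_basis be lt7 II).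
by rewrite intrD intrM.
Qed.

(** The defining property of the Hodge star on basis monomials: a table of 7^4
    values. *)
Lemma starlist_hodge eps (I : seq nat) : size I = 4%N -> all (gtn 7%N) I ->
  lcoef_top (lwedge (philist eps) [:: (1, I)]) =
  \prod_(i <- I) model_sign eps i * lcoef 4%N (starlist eps) (nth 0%N I).
Proof.
case: I => [|i [|j [|k [|l []]]]] // _ /and5P [li lj lk ll _].
have check b : all (fun i => all (fun j => all (fun k => all (fun l =>
    lcoef_top (lwedge (philist b) [:: (1, [:: i; j; k; l])]) ==
    (model_sign b i * (model_sign b j * (model_sign b k * (model_sign b l * 1)))) *
      lcoef 4%N (starlist b) (nth 0%N [:: i; j; k; l]))
    (iota 0%N 7%N)) (iota 0%N 7%N)) (iota 0%N 7%N)) (iota 0%N 7%N).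
  by case: b; vm_compute.
have /allP /(_ i) := check eps; rewrite mem_iota => /(_ li) /allP /(_ j).
rewrite mem_iota => /(_ lj) /allP /(_ k); rewrite mem_iota => /(_ lk) /allP /(_ l).
by rewrite mem_iota => /(_ ll) /eqP ->; rewrite !big_cons big_nil.
Qed.

(** By bilinearity, it is enough to test the Hodge identity on monomials. *)
Lemma model_hodge eps e (g : V -> V -> R) (phi : kform V 3) (b : kform V 4) x :
  basis_of fullv e -> g =2 model_ip eps e -> phi =1 model eps e -> is_form b ->
  wedge phi b x =
  form_inner g (form_of e (starlist eps)) b * mono e (iota 0%N 7%N) (x : {ffun 'I_7 -> V}).
Proof.
move=> be gE phiE fb; pose il (I : {ffun 'I_4 -> 'I_7}) := [seq val (I l) | l : 'I_4].
have size_il I : size (il I) = 4%N by rewrite size_map -cardE card_ord.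
have il7 I : all (gtn 7%N) (il I) by apply/allP => _ /mapP [l _ ->]; apply: ltn_ord.
have nth_il I (l : 'I_4) : nth 0%N (il I) l = I l.
  by rewrite (nth_map l) ?size_enum_ord // nth_ord_enum.
have bE : b =1 fun y => \sum_(I : {ffun 'I_4 -> 'I_7})
    (4`!%:R^-1 * b [ffun l => e`_(I l)]) * form_of e [:: (1, il I)] y.
  move=> y; rewrite (form_mono_expand y be fb) mulr_sumr; apply: eq_bigr => I _.
  by rewrite /form_of big_seq1 /= mul1r mulrA.
have {}phiE : phi =1 form_of e (philist eps) by move=> y; rewrite phiE model_form_of.
rewrite (eq_wedge phiE bE) wedge_sumr (form_inner_basis be gE (form_of_form _ _ _) fb).
rewrite -mulrA mulr_suml mulr_sumr; apply: eq_bigr => I _.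
rewrite (@form_of_wedge _ _ e 3 4); last by case: eps {gE phiE}.
rewrite form_of_top; last first.
  have [] := (size_il I, il7 I); case: (il I) => [|i [|j [|k [|l []]]]] // _ /= il7I.
  by case: eps {gE phiE}; rewrite /has_deg /= il7I.
rewrite starlist_hodge // (form_of_basis (I' := nth 0%N (il I)) be); last 2 first.
- by case: eps {gE phiE}.
- exact: nth_il.
rewrite big_image intrM rmorph_prod /=.
have aux (c p l m d : R) : c * d * (p * l * m) = c * (p * (l * d) * m) by ring.
exact: aux.
Qed.

(** On basis vectors J, the monomial I is nonzero only if J is a rearrangement of
    I; repeated indices in I make rearrangements coincide, which the sum over
    permutations accounts for. *)
Lemma sum_mono_basis e k (I : {ffun 'I_k -> 'I_7}) (F : {ffun 'I_k -> 'I_7} -> R) :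
  basis_of fullv e ->
  \sum_(J : {ffun 'I_k -> 'I_7}) F J * mono e [seq val (I l) | l : 'I_k] [ffun l => e`_(J l)]
  = \sum_(s : 'S_k) (-1) ^+ s * F [ffun l => I (s l)].
Proof.
move=> be; rewrite (reindex_inj invg_inj) /=.
under eq_bigr do rewrite /mono mulr_sumr.
rewrite exchange_big /=; apply: eq_bigr => s _.
rewrite (bigD1 [ffun l => I (s^-1%g l)]) //= [X in _ + X]big1 ?addr0 => [|J /eqP JI].
  rewrite mulrC odd_permV; congr (_ * _).
    rewrite -[RHS]mulr1; congr (_ * _); apply: big1 => l _.
    by rewrite mxE (nth_map l) ?size_enum_ord // nth_ord_enum !ffunE permK crd_basis // eqxx.
have [l Jl] : exists l, I l != J (s l).
  apply/existsP; rewrite -negb_forall; apply/negP => /forallP E; apply: JI.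
  by apply/ffunP => l; rewrite ffunE (eqP (E _)) permKV.
rewrite (bigD1 l) //= mxE (nth_map l) ?size_enum_ord // nth_ord_enum ffunE crd_basis //.
by rewrite val_eqE (negbTE Jl) !(mul0r, mulr0).
Qed.

Lemma form_inner_mono eps e (g : V -> V -> R) k (a : kform V k) (I : {ffun 'I_k -> 'I_7}) :
  basis_of fullv e -> g =2 model_ip eps e -> is_form a ->
  form_inner g a (mono e [seq val (I l) | l : 'I_k] (k := k)) =
  (\prod_l (model_sign eps (I l))%:~R) * a [ffun l => e`_(I l)].
Proof.
move=> be gE fa; rewrite (form_inner_basis be gE fa (mono_form _ _ _)).
apply: (mulfI (_ : k`!%:R != 0 :> R)); first by rewrite pnatr_eq0 gtn_eqF ?fact_gt0.
rewrite mulVKf ?pnatr_eq0 ?gtn_eqF ?fact_gt0 //.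
rewrite (eq_bigr _ (fun J _ => mulrA _ _ _)).
rewrite (sum_mono_basis I (fun J => (\prod_l (model_sign eps (J l))%:~R) * a [ffun l => e`_(J l)]) be).
rewrite -card_Sn -sumr_const mulr_suml; apply: eq_bigr => s _.
have -> : [ffun l => e`_([ffun l0 => I (s l0)] l)] = fcomp [ffun l => e`_(I l)] s.
  by apply/ffunP => l; rewrite !ffunE.
have aux (x y z : R) : x * (y * (x * z)) = x * x * (y * z) by ring.
rewrite form_perm // aux -signr_addb addbb !mul1r; congr (_ * _).
rewrite [RHS](reindex_inj (@perm_inj _ s)) /=.
by apply: eq_bigr => l _; rewrite ffunE.
Qed.

(** Testing the Hodge identity on the monomial I recovers, up to sign, the value
    of the star form on the basis vectors I, so the identity has one solution. *)
Lemma model_hodge_unique eps e (g : V -> V -> R) vol (phi : kform V 3) star :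
  basis_of fullv e -> g =2 model_ip eps e -> phi =1 model eps e ->
  vol [ffun i => tnth e i] = 1 -> is_hodge_star (p := 3) g vol phi star ->
  star =1 form_of e (starlist eps).
Proof.
move=> be gE phiE vol1 [fstar hodge] x.
rewrite (form_mono_expand x be fstar) (form_mono_expand x be (form_of_form _ _ _)).
congr (_ * _); apply: eq_bigr => I _; congr (_ * _).
have := hodge _ (mono_form e [seq val (I l) | l : 'I_4] 4) [ffun i => tnth e i].
rewrite (model_hodge _ be gE phiE (mono_form _ _ _)) mono_top1 // vol1 !mulr1.
rewrite (form_inner_mono I be gE (form_of_form _ _ _)) (form_inner_mono I be gE fstar).
move=> E; apply/esym; move: E; apply: mulfI.
by apply/prodf_neq0 => l _; rewrite /model_sign /model_eps; case: eps {gE phiE}; case: ifP;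
  rewrite ?oner_eq0 // rmorphN oppr_eq0 oner_eq0.
Qed.

Lemma crd_ip eps e (k : 'I_7) x : basis_of fullv e ->
  crd e k x = (model_sign eps k)%:~R * model_ip eps e x e`_k.
Proof.
move=> be; rewrite /model_ip (bigD1 k) //= crd_basis // eqxx mulr1 big1 ?addr0 => [|l lk].
  by rewrite mulrA model_sign_sqr mul1r.
by rewrite crd_basis // (negbTE (lk : l != k :> nat)) mulr0.
Qed.

Lemma ip_basis eps e (i j : 'I_7) : basis_of fullv e ->
  model_ip eps e (tnth e i) (tnth e j) = (model_sign eps i)%:~R * (i == j)%:R.
Proof.
move=> be; rewrite /model_ip (bigD1 i) //= big1 ?addr0 => [|k ki].
  by rewrite !(tnth_nth 0) !crd_basis // eqxx mulr1.
by rewrite (tnth_nth 0) crd_basis // (negbTE (ki : k != i :> nat)) mulr0 mul0r.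
Qed.

Lemma ip_oriented_orthonormal eps e : basis_of fullv e ->
  oriented_orthonormal (model_ip eps e) (mono e (iota 0%N 7%N) (k := 7)) e.
Proof.
move=> be; split=> [|i|i j /negbTE ij]; first exact: mono_top1.
  rewrite /= ip_basis // eqxx mulr1 /model_sign /model_eps.
  by case: eps; case: ifP => _; rewrite ?rmorphN ?normrN normr1.
by rewrite /= ip_basis // ij mulr0.
Qed.

(** Evaluate the defining formula of the metric on the adapted basis, where the
    volume form is 1. *)
Lemma induces_ip eps phi (g : {symmetric V}) vol e :
  induces (model eps) phi g vol -> adapted (model eps) phi e ->
  g =2 model_ip eps e /\ vol [ffun i => tnth e i] = 1.
Proof.
case=> _ gE orth adapt; have [be phiE] := adapt; have [vol1 _ _] := orth _ adapt.
split=> // v w; have := gE v w [ffun i => tnth e i].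
by rewrite vol1 mulr1 (model_metric _ _ _ phiE) mono_top1 // mulr1.
Qed.

(** Two adapted bases give the same tensor g times vol.  If M is the change of
    basis and c its determinant, then c M^T S M = S for the diagonal matrix S of
    signs; taking determinants in dimension 7, c^9 = 1, so c = 1. *)
Lemma adapted_unique eps phi e e' :
  adapted (model eps) phi e -> adapted (model eps) phi e' ->
  mono e (iota 0%N 7%N) [ffun i => tnth e' i] = 1 /\ model_ip eps e =2 model_ip eps e'.
Proof.
move=> [be phiE] [be' phiE'].
have E v w (x : {ffun 'I_7 -> V}) : model_ip eps e v w * mono e (iota 0%N 7%N) x = model_ip eps e' v w * mono e' (iota 0%N 7%N) x.
  by rewrite -(model_metric _ _ _ phiE) -(model_metric _ _ _ phiE').
pose c := mono e (iota 0%N 7%N) [ffun i => tnth e' i].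
have Ec v w : model_ip eps e' v w = model_ip eps e v w * c by rewrite E mono_top1 // mulr1.
pose M := \matrix_(a < 7, b < 7) crd e a (tnth e' b).
pose S : 'M[R]_7 := diag_mx (\row_a (model_sign eps a)%:~R).
have MS : c *: (M^T *m S *m M) = S.
  apply/matrixP => i j; rewrite [RHS]mxE [X in X *+ _]mxE -mulr_natr -(ip_basis _ _ _ be') Ec.
  rewrite mxE mulrC; congr (_ * _); rewrite mul_mx_diag mxE /model_ip.
  by apply: eq_bigr => a _; rewrite !mxE; ring.
have cM : c = \det M.
  by congr (\det _); apply/matrixP => a b; rewrite !mxE ffunE nth_iota // add0n.
have dS : \det S != 0.
  rewrite det_diag; apply/prodf_neq0 => i _; rewrite mxE; apply/eqP => s0.
  by have := model_sign_sqr eps i; rewrite s0 mul0r => /esym/eqP; rewrite oner_eq0.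
have c9 : c ^+ 9 = 1.
  have := congr1 determinant MS; rewrite detZ !det_mulmx det_tr -cM => E9.
  by apply: (mulIf dS); rewrite mul1r -[RHS]E9; ring.
have c1 : c = 1.
  have c0 : 0 <= c.
    rewrite leNgt; apply/negP => cn; have : c ^+ 9 < 0 by rewrite exprn_odd_lt0.
    by rewrite c9 ltr10.
  by apply/eqP; rewrite -(eqrXn2 (n := 9)) // ?c9 ?expr1n.
by split=> // v w; rewrite Ec c1 mulr1.
Qed.

Lemma model_induces eps e : basis_of fullv e ->
  induces (model eps) (model eps e) (model_ip eps e) (mono e (iota 0%N 7%N) (k := 7)).
Proof.
move=> be; split; first exact: mono_form.
  by move=> v w x; rewrite -(@model_metric eps e (model eps e)).
move=> e' ad'; have ad : adapted (model eps) (model eps e) e by [].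
have [vol1 ipE] := adapted_unique ad ad'.
have [_ n1 n0] := ip_oriented_orthonormal eps ad'.1.
by split=> // [i|i j]; rewrite /= ipE; [apply: n1|apply: n0].
Qed.

Lemma model_cocalibrated eps e (br : V -> V -> V) : basis_of fullv e ->
  (forall x, ext_d br (form_of e (starlist eps) (k := 4)) x = 0) ->
  cocalibrated (model eps) br (model eps e) (model_ip eps e) (mono e (iota 0%N 7%N) (k := 7)).
Proof.
move=> be closed; split; last exists (form_of e (starlist eps) (k := 4)) => //.
- split; last by exists e.
  split=> [x i c y z|x i j ij xij]; rewrite !model_form_of; have [lin alt] := form_of_form e 3 (philist eps).
    exact: lin.
  exact: alt ij xij.
- exact: model_induces.
- split; first exact: form_of_form.
  by move=> b fb x; apply: model_hodge.
Qed.

End Structures.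

(** * Normal form of symplectic forms *)

Section Darboux.
Context {F : fieldType} (char2 : (2%:R : F) != 0).

(** For even n, the direct sum of n/2 copies of the standard symplectic plane. *)
Definition std_mx n : 'M[F]_n :=
  \matrix_(i, j) ((~~ odd i && (j == i.+1 :> nat))%:R - (odd i && (i == j.+1 :> nat))%:R).

Lemma std_mx_block n : std_mx (2 + n) = block_mx (std_mx 2) 0 0 (std_mx n).
Proof.
apply/matrixP => i j.
case: (split_ordP i) => k ->; case: (split_ordP j) => l ->;
  rewrite ?(block_mxEul, block_mxEur, block_mxEdl, block_mxEdr) !mxE //=.
- by case: k => [[|[|//]] ?]; rewrite /= ?andbF ?subr0 ?oppr0.
- by case: l => [[|[|//]] ?]; case: k => [[|k] ?]; rewrite !add2n /= ?andbF ?subr0 ?oppr0.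
- by rewrite !negbK !add2n !eqSS.
Qed.

Definition congr_mx n (A B : 'M[F]_n) := exists2 P, P \in unitmx & P *m A *m P^T = B.

Lemma congr_mx_trans n (A B C : 'M[F]_n) : congr_mx A B -> congr_mx B C -> congr_mx A C.
Proof.
move=> [P uP <-] [Q uQ <-]; exists (Q *m P); first by rewrite unitmx_mul uP uQ.
by rewrite trmx_mul !mulmxA.
Qed.

Lemma skew_congr n (A B : 'M[F]_n) : congr_mx A B -> A^T = - A -> B^T = - B.
Proof.
by case=> P _ <- skA; rewrite !trmx_mul trmxK skA mulNmx mulmxN mulmxA.
Qed.

Lemma unit_congr n (A B : 'M[F]_n) : congr_mx A B -> A \in unitmx -> B \in unitmx.
Proof. by case=> P uP <- uA; rewrite !unitmx_mul uP uA unitmx_tr. Qed.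

Lemma skew_diag n (S : 'M[F]_n) i : S^T = - S -> S i i = 0.
Proof.
move=> /matrixP /(_ i i); rewrite !mxE => /eqP.
by rewrite -subr_eq0 opprK -mulr2n -mulr_natl mulf_eq0 (negbTE char2) => /eqP.
Qed.

(** Split off a hyperbolic plane: permute the basis so that the first two vectors
    pair nontrivially, clear the off-diagonal blocks with the inverse of the
    corner K, and use induction on the remaining block. *)
Lemma darboux n (S : 'M[F]_n) : S^T = - S -> S \in unitmx -> congr_mx S (std_mx n).
Proof.
elim/ltn_ind: n S => -[|[|n]] IHn S skS uS.
- by exists 1%:M; rewrite ?unitmx1 //; apply/matrixP => -[].
- by case/negP: (skew_unitmx_even char2 skS uS).
rewrite -[n.+2]/(2 + n)%N in S skS uS *.
have [j Sj] : exists j, S ord0 j != 0.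
  apply/existsP; rewrite -negb_forall; apply/negP => /forallP S0.
  have : row ord0 S = 0 by apply/rowP => j; rewrite !mxE (eqP (S0 j)).
  move/(congr1 (mulmxr (invmx S))); rewrite /= mul0mx -row_mul mulmxV // => /rowP /(_ ord0).
  by rewrite !mxE => /eqP; rewrite oner_eq0.
have j0 : ord0 != j by apply: contra Sj => /eqP <-; rewrite skew_diag.
pose o1 : 'I_(2 + n) := lift ord0 ord0.
pose s := tperm o1 j.
have s0 : s ord0 = ord0 by rewrite tpermD // eq_sym.
pose S1 := perm_mx s *m S *m (perm_mx s)^T.
have c1 : congr_mx S S1 by exists (perm_mx s); rewrite ?unitmx_perm.
have S1E i k : S1 i k = S (s i) (s k).
  rewrite /S1 tr_perm_mx -row_permE -col_permE !mxE.
  by [].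
have S101 : S1 ord0 o1 != 0 by rewrite S1E s0 tpermL.
clearbody S1; have skS1 := skew_congr c1 skS; have uS1 := unit_congr c1 uS.
pose c := S1 ord0 o1; pose K := ulsubmx S1; pose X := ursubmx S1; pose Z := drsubmx S1.
have S1b : S1 = block_mx K X (- X^T) Z.
  rewrite -[LHS]submxK; congr block_mx; apply/matrixP => i k.
  by have /matrixP /(_ (lshift n k) (rshift 2 i)) := skS1; rewrite !mxE => ->; rewrite ?opprK.
have KE : K = c *: std_mx 2.
  have dS l : S1 l l = 0 by apply: skew_diag.
  have d10 : S1 o1 ord0 = - c by have /matrixP /(_ ord0 o1) := skS1; rewrite mxE => ->; rewrite mxE.
  apply/matrixP => i k; rewrite !mxE.
  case: i => [[|[|//]] li]; case: k => [[|[|//]] lk] /=.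
  - by rewrite subrr mulr0 -(dS ord0); congr (S1 _ _); apply: val_inj.
  - by rewrite subr0 mulr1; congr (S1 _ _); apply: val_inj.
  - by rewrite sub0r mulrN1 -d10; congr (S1 _ _); apply: val_inj.
  - by rewrite subrr mulr0 -(dS o1); congr (S1 _ _); apply: val_inj.
have std2 : std_mx 2 *m std_mx 2 = - 1%:M.
  apply/matrixP => i k; rewrite !mxE big_ord_recl big_ord1 !mxE /=.
  by case: i => [[|[|//]] li]; case: k => [[|[|//]] lk] /=; rewrite ?eqxx /=; ring.
have uK : K \in unitmx.
  have : K *m (- c^-1 *: std_mx 2) = 1%:M.
    by rewrite KE -scalemxAl -scalemxAr scalerA std2 mulrN divff // scaleN1r opprK.
  by case/mulmx1_unit.
pose Y := X^T *m invmx K; pose B1 := block_mx 1%:M 0 Y (1%:M : 'M[F]_n).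
have uB1 : B1 \in unitmx by rewrite unitmxE det_lblock !det1 mulr1 unitr1.
pose S2 := B1 *m S1 *m B1^T.
have c2 : congr_mx S1 S2 by exists B1.
have skS2 := skew_congr c2 skS1; have uS2 := unit_congr c2 uS1.
have S2b : exists Z', S2 = block_mx K 0 0 Z'.
  have dl : dlsubmx S2 = 0.
    rewrite /S2 S1b /B1 tr_block_mx !mulmx_block block_mxKdl !trmx1 trmx0.
    by rewrite !(mulmx0, mul1mx, addr0, mulmx1) -mulmxA mulVmx // mulmx1 subrr.
  have ul : ulsubmx S2 = K.
    rewrite /S2 S1b /B1 tr_block_mx !mulmx_block block_mxKul !trmx1 trmx0.
    by rewrite !(mulmx0, mul1mx, mul0mx, addr0, mulmx1).
  have ur : ursubmx S2 = 0.
    have dlN (T : 'M[F]_(2 + n)) : dlsubmx (- T) = - dlsubmx T.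
      by apply/matrixP => i k; rewrite !mxE.
    by rewrite -[LHS]trmxK trmx_ursub skS2 dlN dl oppr0 trmx0.
  by exists (drsubmx S2); rewrite -ul -{1}dl -{1}ur submxK.
have [Z' S2E] := S2b.
have skZ' : Z'^T = - Z'.
  move: skS2; rewrite S2E tr_block_mx opp_block_mx => /eq_block_mx [_ _ _ //].
have uZ' : Z' \in unitmx.
  by move: uS2; rewrite S2E !unitmxE det_ublock unitrM => /andP [].
have [P' uP' PZ'] := IHn n (leqnSn _) Z' skZ' uZ'.
pose D : 'M[F]_2 := diag_mx (\row_i (if i == ord0 then c^-1 else 1)).
have uD : D \in unitmx.
  rewrite unitmxE det_diag big_ord_recl big_ord1 !mxE /= mulr1 unitfE invr_eq0 //.
have DK : D *m K *m D^T = std_mx 2.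
  rewrite KE tr_diag_mx mul_mx_diag mul_diag_mx; apply/matrixP => i k; rewrite !mxE.
  by case: i => [[|[|//]] li]; case: k => [[|[|//]] lk] /=; rewrite ?eqxx /=; field.
apply: congr_mx_trans c1 _; apply: congr_mx_trans c2 _.
exists (block_mx D 0 0 P'); first by rewrite unitmxE det_ublock unitrM -!unitmxE uD.
rewrite S2E tr_block_mx !mulmx_block !(mulmx0, mul0mx, addr0, add0r, trmx0).
by rewrite DK PZ' std_mx_block.
Qed.
End Darboux.

(** * Injectivity of the product with a symplectic form *)

Section Lefschetz.
Context {F : fieldType}.

(** The hypothesis is B /\ S = 0 for the 2-forms with these matrices.  Contracting
    two of the four indices with the inverse of S gives (n - 4) B = - t S, where t
    is the trace of B S^-1; a further trace gives 2 (n - 2) t = 0. *)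
Lemma lefschetz n (S B : 'M[F]_n) :
  (2%:R : F) != 0 -> ((n - 4)%N%:R : F) != 0 -> ((n - 2)%N%:R : F) != 0 ->
  S \in unitmx -> S^T = - S -> B^T = - B ->
  (forall a b c d, B a b * S c d - B a c * S b d + B a d * S b c
                 + S a b * B c d - S a c * B b d + S a d * B b c = 0) -> B = 0.
Proof.
move=> char2 n4 n2 uS skS skB BS; pose X := invmx S.
have lt4n : (4 < n)%N by rewrite -subn_gt0 lt0n; apply: contraNneq n4 => ->.
have skX : X^T = - X.
  have E : (- X^T) *m S = 1%:M by rewrite mulNmx -mulmxN -skS -trmx_mul mulmxV ?trmx1.
  by apply: oppr_inj; rewrite opprK -[LHS]mulmx1 -(mulmxV uS) mulmxA E mul1mx.
have SX i j : \sum_k S i k * X k j = (i == j)%:R.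
  by have /matrixP /(_ i j) := mulmxV uS; rewrite !mxE.
have SXr i j : \sum_k S i k * X j k = - (i == j)%:R.
  rewrite -SX -sumrN; apply: eq_bigr => k _.
  by have /matrixP /(_ k j) := skX; rewrite !mxE => ->; rewrite mulrN.
have delta (f : 'I_n -> F) i : \sum_k f k * (i == k)%:R = f i.
  rewrite (bigD1 i) //= eqxx mulr1 big1 ?addr0 // => k ki.
  by rewrite eq_sym (negbTE ki) mulr0.
have Bba a b : B b a = - B a b by have /matrixP /(_ a b) := skB; rewrite !mxE.
pose t := \tr (B *m X).
have BE : (n - 4)%N%:R *: B = - t *: S.
  have c1 f i : \sum_c \sum_d f c * S i d * X d c = f i.
    rewrite -[RHS]delta; apply: eq_bigr => c _; rewrite -SX mulr_sumr.
    by apply: eq_bigr => d _; rewrite mulrA.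
  have c2 f i : \sum_c \sum_d f d * S i c * X d c = - f i.
    rewrite exchange_big -[f i]delta -sumrN; apply: eq_bigr => d _.
    by rewrite -mulrN -SXr mulr_sumr; apply: eq_bigr => c _; rewrite mulrA.
  have c0 x (Y : 'M_n) : \sum_c \sum_d x * Y c d * X d c = x * \tr (Y *m X).
    rewrite mulr_sumr; apply: eq_bigr => c _; rewrite mxE mulr_sumr.
    by apply: eq_bigr => d _; rewrite mulrA.
  apply/matrixP => a b; rewrite !mxE.
  have : \sum_c \sum_d (B a b * S c d * X d c + - (B a c * S b d * X d c)
      + B a d * S b c * X d c + S a b * B c d * X d c
      + - (B b d * S a c * X d c) + B b c * S a d * X d c) = 0.
    rewrite big1 // => c _; rewrite big1 // => d _.
    by rewrite -[RHS](mul0r (X d c)) -(BS a b c d); ring.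
  under eq_bigr do rewrite !big_split !sumrN.
  rewrite !big_split !sumrN /= !c0 !c1 !c2 Bba -/t mulmxV // mxtrace1 => E.
  by rewrite natrB ?(ltnW lt4n) //; apply/eqP; rewrite -subr_eq0 -E; apply/eqP; ring.
have t0 : t = 0.
  have /(congr1 (fun M => \tr (M *m X))) := BE.
  rewrite -!scalemxAl !mxtraceZ -/t mulmxV // mxtrace1 mulNr => /eqP.
  rewrite -addr_eq0 mulrC -mulrDr -natrD (_ : n - 4 + n = 2 * (n - 2))%N; last by lia.
  by rewrite natrM !mulf_eq0 (negbTE char2) (negbTE n2) !orbF => /eqP.
move: BE; rewrite t0 oppr0 scale0r => /eqP; rewrite scaler_eq0 (negbTE n4) /=.
by move/eqP.
Qed.
End Lefschetz.

(** * Invariant forms and similarity to symplectic endomorphisms *)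

Section SymplecticForms.
Context {R : realType} {U : vectType R}.
Local Notation n := (\dim {:U}).
Local Notation b := (vbasis {:U}).

Definition lfmx (f : 'End(U)) : 'M[R]_n := \matrix_(i, j) coord b j (f b`_i).

Definition formmx (w : U -> U -> R) : 'M[R]_n := \matrix_(i, j) w b`_i b`_j.

Let bb : basis_of {:U} b := vbasisP _.

Lemma lfun_sum (f : 'End(U)) (i : 'I_n) : f b`_i = \sum_j lfmx f i j *: b`_j.
Proof.
rewrite [LHS](coord_basis bb (memvf _)); apply: eq_bigr => j _; by rewrite mxE.
Qed.

Lemma complex_matrixE (f : 'End(U)) : complex_matrix f = map_mx (real_complex R) (lfmx f).
Proof. by apply/matrixP => i j; rewrite !mxE. Qed.

Section Skew.
Variable w : {skew_symmetric U}.

Lemma skewC x y : w x y = - w y x.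
Proof. by rewrite hermC /= expr1 mulN1r. Qed.

Lemma skewZr a x y : w x (a *: y) = a * w x y.
Proof. by rewrite linearZr_LR. Qed.

Lemma skewZl a x y : w (a *: x) y = a * w x y.
Proof. by rewrite linearZl_LR. Qed.

Lemma skew_suml (I : finType) (c : I -> R) (v : I -> U) y :
  w (\sum_i c i *: v i) y = \sum_i c i * w (v i) y.
Proof. by rewrite linear_sumlz; apply: eq_bigr => i _; apply: skewZl. Qed.

Lemma skew_sumr (I : finType) (c : I -> R) (v : I -> U) x :
  w x (\sum_i c i *: v i) = \sum_i c i * w x (v i).
Proof. by rewrite linear_sumr; apply: eq_bigr => i _; apply: skewZr. Qed.

Lemma formmx_skew : (formmx w)^T = - formmx w.
Proof. by apply/matrixP => i j; rewrite !mxE skewC. Qed.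

Lemma formmx_unit : nondegenerate w -> formmx w \in unitmx.
Proof.
move=> /eqP nd; rewrite -row_free_unit -kermx_eq0; apply/rowV0P => v /sub_kermxP vS.
pose x := \sum_j v 0 j *: b`_j.
have : x \in orthov w fullv.
  apply/mem_orthovP => y _; rewrite (coord_basis bb (memvf y)) skew_sumr big1 // => j _.
  rewrite skew_suml; have /rowP /(_ j) := vS; rewrite !mxE => E.
  by rewrite (_ : \sum_i _ = 0) ?mulr0 // -[RHS]E; apply: eq_bigr => i _; rewrite mxE.
rewrite nd memv0 => /eqP x0; apply/rowP => j.
have := basis_free bb => /freeP /(_ (fun j => v 0 j) x0 j) ->.
by rewrite mxE.
Qed.

(** Pulling w back along the conjugating map gives an invariant form.  Conversely
    an invariant form is, by Darboux, the pull-back of w along some automorphism,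
    which conjugates h into the algebra of w. *)
Lemma sp_similarP (h : 'End(U)) : nondegenerate w ->
  (exists2 f, in_sp w f & is_similar h f) <-> exists S, sp_mx (lfmx h) S.
Proof.
move=> nd; have uW := formmx_unit nd; have skW := formmx_skew.
split=> [[f spf [P kerP fE]]|[S [skS uS hS]]].
  have fP x : f (P x) = P (h x) by rewrite fE !lfunE /= !lfunE /= lker0_lfunK.
  pose Q := lfmx P.
  have PE (i : 'I_n) : P b`_i = \sum_j Q i j *: b`_j by apply: lfun_sum.
  have SE (i j : 'I_n) : (Q *m formmx w *m Q^T) i j = w (P b`_i) (P b`_j).
    rewrite [P b`_j]PE skew_sumr mxE; apply: eq_bigr => k _.
    rewrite PE skew_suml mulrC !mxE; congr (_ * _); apply: eq_bigr => l _.
    by rewrite !mxE.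
  exists (Q *m formmx w *m Q^T); split.
  - by rewrite !trmx_mul trmxK skW mulNmx mulmxN mulmxA.
  - have uQ : Q \in unitmx.
      rewrite -row_free_unit -kermx_eq0; apply/rowV0P => v /sub_kermxP vQ.
      have Pv : P (\sum_j v 0 j *: b`_j) = 0.
        rewrite linear_sum (eq_bigr (fun j => \sum_k (v 0 j * Q j k) *: b`_k)) => [|j _].
          rewrite exchange_big big1 //= => k _; rewrite -scaler_suml.
          have /rowP /(_ k) := vQ; rewrite !mxE => ->; exact: scale0r.
        by rewrite linearZ /= PE scaler_sumr; apply: eq_bigr => k _; rewrite scalerA.
      have : \sum_j v 0 j *: b`_j \in lker P by rewrite memv_ker Pv.
      rewrite (eqP kerP) memv0 => /eqP x0; apply/rowP => j.
      by have := basis_free bb => /freeP /(_ (fun j => v 0 j) x0 j) ->; rewrite mxE.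
    by rewrite !unitmx_mul unitmx_tr uQ uW.
  - apply/matrixP => i j; rewrite [LHS]mxE [RHS]mxE -(spf (P b`_i) (P b`_j)).
    congr (_ + _).
      rewrite fP (lfun_sum h i) linear_sum /=.
      rewrite (eq_bigr (fun k => lfmx h i k *: P b`_k)) => [|k _]; last by rewrite linearZ.
      by rewrite skew_suml mxE; apply: eq_bigr => k _; rewrite SE.
    rewrite fP (lfun_sum h j) linear_sum /=.
    rewrite (eq_bigr (fun k => lfmx h j k *: P b`_k)) => [|k _]; last by rewrite linearZ.
    by rewrite skew_sumr mxE; apply: eq_bigr => k _; rewrite SE [_^T _ _]mxE mulrC.
have char2 : (2%:R : R) != 0 by rewrite pnatr_eq0.
have [B uB BS] := darboux char2 skS uS; have [C uC CW] := darboux char2 skW uW.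
(* The automorphism with matrix K on the basis pulls w back to S. *)
pose K := invmx B *m C; have uK : K \in unitmx by rewrite unitmx_mul unitmx_inv uB.
have SK : S = K *m formmx w *m K^T.
  rewrite /K trmx_mul !mulmxA -(mulmxA _ C) -(mulmxA _ (C *m _)) CW -BS.
  by rewrite !mulmxA mulVmx // mul1mx -mulmxA -trmx_mul mulVmx // trmx1 mulmx1.
clearbody K.
have [P PE] : exists P : 'End(U), forall i : 'I_n, P b`_i = \sum_j K i j *: b`_j.
  pose v := [tuple \sum_j K i j *: b`_j | i < n].
  have [P0 P0E] := linear_of_free b v; exists (linfun P0) => i.
  rewrite lfunE /= -(nth_map 0 0) ?size_tuple // P0E ?size_tuple ?(basis_free bb) //.
  by rewrite -[LHS]/(nth 0 v i) -tnth_nth tnth_mktuple.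
pose rv x : 'rV[R]_n := \row_i coord b i x.
have Px x : P x = \sum_j (rv x *m K) 0 j *: b`_j.
  rewrite {1}(coord_basis bb (memvf x)) linear_sum.
  rewrite (eq_bigr (fun i => \sum_j (coord b i x * K i j) *: b`_j)) => [|i _].
    rewrite exchange_big; apply: eq_bigr => j _; rewrite -scaler_suml mxE; congr (_ *: _).
    by apply: eq_bigr => i _; rewrite mxE.
  by rewrite linearZ /= PE scaler_sumr; apply: eq_bigr => j _; rewrite scalerA.
have kerP : lker P == 0%VS.
  apply/lker0P => x y; rewrite !Px => E.
  have {}E : rv x *m K = rv y *m K.
    apply/rowP => j; apply/eqP; rewrite -subr_eq0; apply/eqP.
    have := basis_free bb => /freeP /(_ (fun j => (rv x *m K) 0 j - (rv y *m K) 0 j)); apply.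
    by under eq_bigr do rewrite scalerBl; rewrite sumrB E subrr.
  have {}E : rv x = rv y by rewrite -[rv x]mulmx1 -(mulmxV uK) mulmxA E -mulmxA mulmxV ?mulmx1.
  rewrite (coord_basis bb (memvf x)) (coord_basis bb (memvf y)).
  by apply: eq_bigr => i _; have /rowP /(_ i) := E; rewrite !mxE => ->.
have wP x y : w (P x) (P y) = (rv x *m S *m (rv y)^T) 0 0.
  have -> : rv x *m S *m (rv y)^T = (rv x *m K) *m formmx w *m (rv y *m K)^T.
    by rewrite SK trmx_mul !mulmxA.
  rewrite (Px x) (Px y) skew_sumr mxE; apply: eq_bigr => j _.
  rewrite skew_suml mulrC; congr (_ * _); last by rewrite [RHS]mxE.
  by rewrite [RHS]mxE; apply: eq_bigr => i _; rewrite [formmx w _ _]mxE.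
have rvh x : rv (h x) = rv x *m lfmx h.
  apply/rowP => j; rewrite mxE {1}(coord_basis bb (memvf x)) !linear_sum /= mxE.
  by apply: eq_bigr => i _; rewrite !linearZ !mxE.
exists (P \o h \o P^-1)%VF; last by exists P.
have fP z : (P \o h \o P^-1)%VF (P z) = P (h z) by rewrite !lfunE /= !lfunE /= lker0_lfunK.
move=> x y; rewrite -[x](lker0_lfunVK kerP) -[y](lker0_lfunVK kerP).
move: (P^-1%VF x) (P^-1%VF y) => {}x {}y; rewrite !fP !wP !rvh trmx_mul.
have := congr1 (fun M => (rv x *m M *m (rv y)^T) 0 0) hS.
by rewrite /= mulmxDr mulmxDl mulmx0 mul0mx !mulmxA [X in X = _ -> _]mxE [X in _ = X -> _]mxE.
Qed.
End Skew.
End SymplecticForms.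

(** * Closed 4-forms and abelian ideals *)

Section Closed4.
Context {R : realType} {V : vectType R}.

Definition arg4 (a b c d : V) : {ffun 'I_4 -> V} := [ffun l => nth 0 [:: a; b; c; d] (val l)].
Definition arg5 (a b c d e : V) : {ffun 'I_5 -> V} := [ffun l => nth 0 [:: a; b; c; d; e] (val l)].

Lemma arg5E (x : {ffun 'I_5 -> V}) :
  x = arg5 (x (inord 0)) (x (inord 1)) (x (inord 2)) (x (inord 3)) (x (inord 4)).
Proof.
apply/ffunP => -[[|[|[|[|[|//]]]]] lt]; rewrite !ffunE /=; congr (x _);
  by apply: val_inj; rewrite /= inordK.
Qed.

Lemma ext_d4 (br : V -> V -> V) (a : kform V 4) x0 x1 x2 x3 x4 :
  ext_d br a (arg5 x0 x1 x2 x3 x4) =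
    - a (arg4 (br x0 x1) x2 x3 x4) + a (arg4 (br x0 x2) x1 x3 x4)
    - a (arg4 (br x0 x3) x1 x2 x4) + a (arg4 (br x0 x4) x1 x2 x3)
    + a (arg4 x0 (br x1 x2) x3 x4) - a (arg4 x0 (br x1 x3) x2 x4)
    + a (arg4 x0 (br x1 x4) x2 x3) - a (arg4 x0 x1 (br x2 x3) x4)
    + a (arg4 x0 x1 (br x2 x4) x3) + a (arg4 x0 x1 x2 (br x3 x4)).
Proof.
rewrite /ext_d.
under eq_bigr do rewrite big_mkcond !big_ord_recl big_ord0.
rewrite !big_ord_recl big_ord0 /= !addr0 !add0r.
have E (u v : {ffun 'I_4 -> V}) : (forall l, u l = v l) -> a u = a v.
  by move=> uv; congr a; apply/ffunP.
transitivity (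
  ((-1) ^+ 1 * a (arg4 (br x0 x1) x2 x3 x4) + ((-1) ^+ 2 * a (arg4 (br x0 x2) x1 x3 x4)
    + ((-1) ^+ 3 * a (arg4 (br x0 x3) x1 x2 x4) + (-1) ^+ 4 * a (arg4 (br x0 x4) x1 x2 x3))))
  + (((-1) ^+ 2 * a (arg4 x0 (br x1 x2) x3 x4) + ((-1) ^+ 3 * a (arg4 x0 (br x1 x3) x2 x4)
    + (-1) ^+ 4 * a (arg4 x0 (br x1 x4) x2 x3)))
  + (((-1) ^+ 3 * a (arg4 x0 x1 (br x2 x3) x4) + (-1) ^+ 4 * a (arg4 x0 x1 (br x2 x4) x3))
  + (-1) ^+ 4 * a (arg4 x0 x1 x2 (br x3 x4))))); last by ring.
by repeat (congr (_ + _)); congr (_ * _); apply: E => -[[|[|[|[|//]]]] ?]; rewrite !ffunE.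
Qed.

(** In the differential evaluated on z and four vectors of u, only the brackets
    with z survive; what remains is the action of ad z on the form. *)
Lemma closed_on_ideal (br : V -> V -> V) (a : kform V 4) (u : {vspace V}) z y1 y2 y3 y4 :
  is_form a -> (forall x y, x \in u -> y \in u -> br x y = 0) ->
  y1 \in u -> y2 \in u -> y3 \in u -> y4 \in u ->
  (forall x, ext_d br a x = 0) ->
  a (arg4 (br z y1) y2 y3 y4) + a (arg4 y1 (br z y2) y3 y4)
  + a (arg4 y1 y2 (br z y3) y4) + a (arg4 y1 y2 y3 (br z y4)) = 0.
Proof.
move=> fa ab u1 u2 u3 u4 cl.
have swap (x : {ffun 'I_4 -> V}) (i j : 'I_4) y : i != j ->
    y = fcomp x (tperm i j) -> a y = - a x.
  by move=> ij ->; apply: form_tperm.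
have a0 (x : {ffun 'I_4 -> V}) (i : 'I_4) : x i = 0 -> a x = 0.
  move=> xi; have := fa.1 x i (-1) 0 0; rewrite scaler0 addr0 mulN1r addNr.
  by move=> <-; congr a; apply/ffunP => l; rewrite ffunE; case: eqP => // ->.
have := cl (arg5 z y1 y2 y3 y4); rewrite ext_d4.
rewrite (ab _ _ u1 u2) (ab _ _ u1 u3) (ab _ _ u1 u4) (ab _ _ u2 u3) (ab _ _ u2 u4) (ab _ _ u3 u4).
rewrite (a0 (arg4 z 0 y3 y4) (inord 1)); last by rewrite ffunE /= inordK.
rewrite (a0 (arg4 z 0 y2 y4) (inord 1)); last by rewrite ffunE /= inordK.
rewrite (a0 (arg4 z 0 y2 y3) (inord 1)); last by rewrite ffunE /= inordK.
rewrite (a0 (arg4 z y1 0 y4) (inord 2)); last by rewrite ffunE /= inordK.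
rewrite (a0 (arg4 z y1 0 y3) (inord 2)); last by rewrite ffunE /= inordK.
rewrite (a0 (arg4 z y1 y2 0) (inord 3)); last by rewrite ffunE /= inordK.
have s01 w x y t : a (arg4 w x y t) = - a (arg4 x w y t).
  apply: (swap _ (inord 0) (inord 1)); first by rewrite -val_eqE /= !inordK.
  apply/ffunP => l; rewrite !ffunE; case: tpermP => [->|->|]; rewrite /= ?inordK //.
  by case: l => [[|[|[|[|//]]]] lt] n0 n1 //; [case: n0|case: n1]; apply: val_inj; rewrite /= inordK.
have s12 w x y t : a (arg4 w x y t) = - a (arg4 w y x t).
  apply: (swap _ (inord 1) (inord 2)); first by rewrite -val_eqE /= !inordK.
  apply/ffunP => l; rewrite !ffunE; case: tpermP => [->|->|]; rewrite /= ?inordK //.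
  by case: l => [[|[|[|[|//]]]] lt] n0 n1 //; [case: n0|case: n1]; apply: val_inj; rewrite /= inordK.
have s23 w x y t : a (arg4 w x y t) = - a (arg4 w x t y).
  apply: (swap _ (inord 2) (inord 3)); first by rewrite -val_eqE /= !inordK.
  apply/ffunP => l; rewrite !ffunE; case: tpermP => [->|->|]; rewrite /= ?inordK //.
  by case: l => [[|[|[|[|//]]]] lt] n0 n1 //; [case: n0|case: n1]; apply: val_inj; rewrite /= inordK.
rewrite (s01 (br z y2)) (s01 (br z y3)) (s12 _ (br z y3)) (s01 (br z y4)) (s12 _ (br z y4)).
rewrite (s23 _ _ (br z y4)) => E; apply: oppr_inj; rewrite oppr0 -[RHS]E; ring.
Qed.
End Closed4.

(** * Algebraic identities of the models *)

Section Identities.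
Context {A : comNzRingType}.
Implicit Types x y z t n : nat -> A.

(** The forms of the models as polynomials in the coordinates of their arguments,
    over any commutative ring, so that their identities are decided by [ring]. *)
Definition coord_form k (L : seq (int * seq nat)) (c : seq (nat -> A)) : A :=
  foldr (fun m s => m.1%:~R * detl k (fun a b => nth (fun=> 0) c b (nth 0%N m.2 a)) + s) 0 L.

Definition dot eps x y : A :=
  foldr (fun i s => (model_sign eps i)%:~R * x i * y i + s) 0 (iota 0%N 7%N).

Definition phi3 eps x y z := coord_form 3 (philist eps) [:: x; y; z].
Definition star4 eps x y z t := coord_form 4 (starlist eps) [:: x; y; z; t].

(** With w the contraction of phi with n: w /\ w / 2 = g(n, n) star - n^# /\ (n _| star),
    where n^# is the 1-form g(n, -).  On the orthogonal complement of n only the first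
    term remains. *)
Lemma star_contract eps n x y z t :
  phi3 eps n x y * phi3 eps n z t - phi3 eps n x z * phi3 eps n y t
    + phi3 eps n x t * phi3 eps n y z =
  dot eps n n * star4 eps x y z t - dot eps n x * star4 eps n y z t
  + dot eps n y * star4 eps n x z t - dot eps n z * star4 eps n x y t
  + dot eps n t * star4 eps n x y z.
Proof.
case: eps; rewrite /phi3 /star4 /coord_form /dot /model_sign /=; ring.
Qed.

Definition unitv (k : nat) : nat -> A := fun i => (i == k)%:R.

(** For the cross product defined by g and phi, n x (n x v) = g(n, v) n - g(n, n) v;
    the sum is the scalar product of the left side with z, for v the variable x. *)
Lemma cross_cross eps n x z :
  foldr (fun k s => (model_sign eps k)%:~R * phi3 eps n x (unitv k) * phi3 eps n (unitv k) z + s)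
    0 (iota 0%N 7%N)
  = dot eps n x * dot eps n z - dot eps n n * dot eps x z.
Proof.
case: eps; rewrite /phi3 /coord_form /dot /model_sign /unitv /=; ring.
Qed.

(** The dual 4-form of a model is omega2 ^ 2 / 2 + e^7 /\ rho3, see [star_split]. *)
Definition omega2 eps x y :=
  coord_form 2 [:: (model_eps eps, [:: 0; 1]%N); (model_eps eps, [:: 2; 3]%N); (1, [:: 4; 5]%N)] [:: x; y].

Definition rho3 x y z :=
  coord_form 3 [:: (1, [:: 1; 3; 5]%N); (-1, [:: 1; 2; 4]%N); (-1, [:: 0; 3; 4]%N);
            (-1, [:: 0; 2; 5]%N)] [:: x; y; z].

Lemma star_split eps x y z t :
  star4 eps x y z t =
  omega2 eps x y * omega2 eps z t - omega2 eps x z * omega2 eps y t + omega2 eps x t * omega2 eps y z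
  + x 6%N * rho3 y z t - y 6%N * rho3 x z t + z 6%N * rho3 x y t - t 6%N * rho3 x y z.
Proof.
case: eps; rewrite /star4 /omega2 /rho3 /coord_form /=; ring.
Qed.
End Identities.

(** * The two implications between cocalibrated structures and invariant forms *)

Section Evaluation.
Context {R : realType} {V : vectType R}.
Implicit Types (e : 7.-tuple V) (eps : bool).

Definition crds e (x : V) : nat -> R := fun i => crd e i x.

Lemma form_of_coord_form e k L (ys : seq V) : size ys = k ->
  form_of e L [ffun l : 'I_k => nth 0 ys (val l)] = coord_form k L [seq crds e y | y <- ys].
Proof.
move=> sy; rewrite /form_of /coord_form; elim: L => [|m L IHL]; first by rewrite big_nil.
rewrite big_cons IHL; congr (_ * _ + _).
rewrite detlE /mono; congr (\det _); apply/matrixP => a b; rewrite !mxE ffunE.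
by rewrite (nth_map 0) ?sy.
Qed.

Lemma ip_dot eps e x y : model_ip eps e x y = dot eps (crds e x) (crds e y).
Proof. by rewrite /model_ip /dot !big_ord_recl big_ord0. Qed.
End Evaluation.

Section Hyperplane.
Context {R : realType} {V : vectType R}.

Lemma dim_subvs (u : {vspace V}) : \dim {:subvs_of u} = \dim u.
Proof. by rewrite dimvf. Qed.

(** t is the coordinate along z of the decomposition V = u + R z. *)
Lemma hyperplane_functional (u : {vspace V}) (z : V) :
  \dim {:V} = (\dim u).+1 -> z \notin u ->
  exists t : {linear V -> R^o}, [/\ t z = 1, forall x, x \in u -> t x = 0 &
    forall x, x - t x *: z \in u].
Proof.
move=> dimV zu; pose X := [tuple of z :: vbasis u].
have bu := vbasisP u.
have fX : free X by rewrite free_cons (basis_free bu) andbT (span_basis bu).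
have bX : basis_of fullv X.
  by rewrite basisEfree fX subvf /= size_tuple dimV.
pose t : {linear V -> R^o} := coord X ord0.
have tz : t z = 1 by rewrite -[RHS]/((ord0 == ord0 :> 'I_(\dim u).+1)%:R) -(coord_free _ _ fX).
have tu x : x \in u -> t x = 0.
  move=> /(coord_basis bu) ->; rewrite linear_sum big1 // => i _; rewrite linearZ /=.
  have := coord_free (lift ord0 i) ord0 fX; rewrite /= => E.
  by rewrite /t -[(vbasis u)`_i]/(X`_(lift ord0 i)) E scaler0.
exists t; split=> // x; rewrite {1}(coord_basis bX (memvf x)) big_ord_recl /=.
rewrite addrAC subrr add0r; apply: memv_suml => i _; apply: memvZ.
apply: vbasis_mem; apply: mem_nth; rewrite size_tuple; exact: ltn_ord.
Qed.

Lemma orthogonal_vector eps (e : 7.-tuple V) (t : {linear V -> R^o}) : basis_of fullv e ->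
  exists v, forall x, model_ip eps e v x = t x.
Proof.
move=> be; exists (\sum_(i < 7) ((model_sign eps i)%:~R * t e`_i) *: e`_i) => x.
rewrite {2}(crd_sum x be) linear_sum /model_ip; apply: eq_bigr => i _.
rewrite linearZ /= {1}(_ : crd e i _ = (model_sign eps i)%:~R * t e`_i).
  by rewrite mulrA model_sign_sqr mul1r mulrC.
rewrite /crd linear_sum (bigD1 i) //= linearZ /= -/(crd e i _) crd_basis // eqxx mulr1.
rewrite big1 ?addr0 // => j ji; rewrite linearZ /= -/(crd e i _) crd_basis //.
by rewrite eq_sym (negbTE (ji : j != i :> nat)) mulr0.
Qed.
End Hyperplane.

Section Adjoint.
Context {R : realType} {V : vectType R} (br : {bilinear V -> V -> V}) (u : {vspace V}) (z : V).

Definition ad_fun (v : subvs_of u) : subvs_of u := vsproj u (br z (vsval v)).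

Lemma ad_fun_linear : linear ad_fun.
Proof. by move=> a x y; rewrite /ad_fun !linearP. Qed.

HB.instance Definition _ := GRing.isLinear.Build R (subvs_of u) (subvs_of u) _ ad_fun ad_fun_linear.

Lemma ad_onE v : is_abelian_ideal br u -> vsval (ad_on br u z v) = br z (vsval v).
Proof.
move=> [ideal _]; rewrite -[ad_on br u z]/(linfun ad_fun) lfunE /= /ad_fun vsprojK //.
exact: ideal (subvsP v).
Qed.

Lemma ad_on_basis (i : 'I_(\dim {:subvs_of u})) : is_abelian_ideal br u ->
  br z (vsval (vbasis {:subvs_of u})`_i) =
  \sum_j lfmx (ad_on br u z) i j *: vsval (vbasis {:subvs_of u})`_j.
Proof.
by move=> id; rewrite -ad_onE // lfun_sum linear_sum; apply: eq_bigr => j _; rewrite linearZ.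
Qed.
End Adjoint.

(** For maps that are known to be linear only through an equation, such as one
    slot of a form. *)
Lemma linear_form_sum (R : realType) (V : vectType R) (f : V -> R) (I : finType) (c : I -> R)
    (v : I -> V) :
  (forall a x y, f (a *: x + y) = a * f x + f y) ->
  f (\sum_i c i *: v i) = \sum_i c i * f (v i).
Proof.
move=> lin; have f0 : f 0 = 0 by have := lin (-1) 0 0; rewrite scaler0 addr0 mulN1r addNr.
by elim/big_rec2: _ => [//|i y x _ <-]; rewrite lin.
Qed.

Section NormalForm.
Context {R : realType} {V : vectType R} (br : {bilinear V -> V -> V}).
Variables (u : {vspace V}) (z : V).
Hypotheses (dim_V : \dim {:V} = 7%N) (dim_u : \dim u = 6%N) (zu : z \notin u).
Hypothesis ideal_u : is_abelian_ideal br u.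
Local Notation vb := (vbasis {:subvs_of u}).

Lemma arg4E (x y v w : V) : arg4 x y v w = [ffun l : 'I_4 => nth 0 [:: x; y; v; w] (val l)].
Proof. by []. Qed.

(** The invariant form is w = n _| phi for a vector n orthogonal to u.  It is
    nondegenerate on u since the cross product with n
    has square -g(n, n) on u; it is invariant by closedness of the dual 4-form
    and injectivity of the product with w. *)
Lemma cocalibrated_sp eps phi (metric : {symmetric V}) vol :
  cocalibrated (model eps) br phi metric vol -> nondegenerate_on metric u ->
  exists S, sp_mx (lfmx (ad_on br u z)) S.
Proof.
move=> [[fphi [e ad_e]] ind [star star_hodge closed]] ndu.
have [gE vol1] := induces_ip ind ad_e; have [be phiE] := ad_e.
have starE := model_hodge_unique be gE phiE vol1 star_hodge.
have fstar := star_hodge.1.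
have [t [tz tu ut]] := hyperplane_functional (etrans dim_V (congr1 S (esym dim_u))) zu.
have [n nE] := orthogonal_vector eps t be.
have nn0 : model_ip eps e n n != 0.
  apply/eqP => nn.
  have nu : n \in u by have := ut n; rewrite -nE nn scale0r subr0.
  have : n \in (u :&: orthov metric u)%VS.
    by rewrite memv_cap nu; apply/mem_orthovP => x xu; rewrite gE nE tu.
  rewrite ndu memv0 => /eqP n0; have := nE z; rewrite n0 tz /model_ip big1 => [/eqP|i _].
    by rewrite eq_sym oner_eq0.
  by rewrite /crd linear0 mulr0 mul0r.
have nu x : x \in u -> dot eps (crds e n) (crds e x) = 0 by move=> xu; rewrite -ip_dot nE tu.
pose w x y : R := phi3 eps (crds e n) (crds e x) (crds e y).
have w_star x1 x2 x3 x4 : x1 \in u -> x2 \in u -> x3 \in u -> x4 \in u ->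
    w x1 x2 * w x3 x4 - w x1 x3 * w x2 x4 + w x1 x4 * w x2 x3 =
    model_ip eps e n n * star (arg4 x1 x2 x3 x4).
  move=> u1 u2 u3 u4; rewrite /w star_contract (nu _ u1) (nu _ u2) (nu _ u3) (nu _ u4).
  rewrite !mul0r !subr0 !addr0; by rewrite starE arg4E form_of_coord_form // ip_dot.
have wl y a x x' : w (a *: x + x') y = a * w x y + w x' y.
  rewrite /w /phi3 /coord_form /= /crds !crdP; ring.
have wC x y : w y x = - w x y by rewrite /w /phi3 /coord_form /=; ring.
have wr y a x x' : w y (a *: x + x') = a * w y x + w y x'.
  by rewrite wC wl opprD -mulrN -!wC.
have wn x : w x n = 0 by rewrite /w /phi3 /coord_form /=; ring.
have wnd x : x \in u -> (forall y, y \in u -> w x y = 0) -> x = 0.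
  move=> xu wx; have {}wx y : w x y = 0.
    have yu : y - (t y / t n) *: n \in u.
      have t0 : t (y - (t y / t n) *: n) = 0.
        rewrite linearB linearZ /= -[_ *: t n]/(t y / t n * t n) divfK ?subrr //.
        by rewrite -nE.
      by have := ut (y - (t y / t n) *: n); rewrite t0 scale0r subr0.
    by rewrite -[y](subrK ((t y / t n) *: n)) addrC wr wn mulr0 add0r wx.
  have dx y : dot eps (crds e x) (crds e y) = 0.
    have phi0 k : (k < 7)%N -> phi3 eps (crds e n) (crds e x) (unitv k) = 0 :> R.
      move=> lt7; rewrite -(wx e`_k) /w /phi3 /coord_form /= /crds /unitv.
      by rewrite !(crd_basis be).
    have := cross_cross eps (crds e n) (crds e x) (crds e y).
    rewrite (nu x xu) mul0r sub0r -(ip_dot _ _ n) (_ : foldr _ _ _ = 0).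
      by move=> /esym/eqP; rewrite oppr_eq0 mulf_eq0 (negbTE nn0) => /eqP.
    have : all (gtn 7%N) (iota 0%N 7%N) by [].
    by elim: (iota _ _) => //= k l IHl /andP [/phi0 -> /IHl ->]; rewrite mulr0 mul0r addr0.
  rewrite (crd_sum x be) big1 // => k _.
  by rewrite (crd_ip eps _ _ be) ip_dot dx mulr0 scale0r.
pose D x := br z x.
have Du x : x \in u -> D x \in u by apply: ideal_u.1.
have DE x : D x = br z x by [].
clearbody w D.
(* The action of D on both sides of w_star; this is (D . w) /\ w = 0. *)
have rel x1 x2 x3 x4 : x1 \in u -> x2 \in u -> x3 \in u -> x4 \in u ->
  (w (D x1) x2 + w x1 (D x2)) * w x3 x4 - (w (D x1) x3 + w x1 (D x3)) * w x2 x4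
  + (w (D x1) x4 + w x1 (D x4)) * w x2 x3 + w x1 x2 * (w (D x3) x4 + w x3 (D x4))
  - w x1 x3 * (w (D x2) x4 + w x2 (D x4)) + w x1 x4 * (w (D x2) x3 + w x2 (D x3)) = 0.
  move=> u1 u2 u3 u4.
  have /(congr1 ( *%R (model_ip eps e n n))) :=
    @closed_on_ideal _ _ br star u z _ _ _ _ fstar ideal_u.2 u1 u2 u3 u4 closed.
  rewrite -!DE mulr0 !mulrDr -!w_star ?Du // => E; rewrite -[RHS]E; ring.
pose b (i : 'I_(\dim {:subvs_of u})) := vsval vb`_i.
have bu i : b i \in u by apply: subvsP.
pose A := lfmx (ad_on br u z).
have Db i : D (b i) = \sum_j A i j *: b j by rewrite DE; apply: ad_on_basis.
pose S := \matrix_(i, j) w (b i) (b j) : 'M[R]_(\dim {:subvs_of u}).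
have SE i j : S i j = w (b i) (b j) by rewrite mxE.
have skS : S^T = - S by apply/matrixP => i j; rewrite !mxE wC.
have uS : S \in unitmx.
  rewrite -row_free_unit -kermx_eq0; apply/rowV0P => v /sub_kermxP vS.
  pose x := \sum_j v 0 j *: vb`_j.
  have vx : vsval x = \sum_j v 0 j *: b j.
    by rewrite linear_sum; apply: eq_bigr => j _; rewrite linearZ.
  have x0 : x = 0.
    apply: val_inj; rewrite [RHS]linear0; apply: wnd; first exact: subvsP.
    move=> y yu; have -> : y = \sum_j coord vb j (vsproj u y) *: b j.
      rewrite -{1}(vsprojK yu) {1}(coord_basis (vbasisP _) (memvf (vsproj u y))) linear_sum.
      by apply: eq_bigr => j _; rewrite linearZ.
    rewrite (linear_form_sum _ _ (wr (\val x))) big1 // => j _; rewrite [\val x]vx.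
    rewrite (linear_form_sum _ _ (wl _)); have /rowP /(_ j) := vS; rewrite !mxE => E.
    rewrite (_ : \sum_i _ = 0) ?mulr0 // -[RHS]E; apply: eq_bigr => i _.
    by rewrite SE.
  apply/rowP => j; have := basis_free (vbasisP {:subvs_of u}) => /freeP /(_ (fun j => v 0 j) x0 j).
  by move=> ->; rewrite mxE.
exists S; split=> //; have dimS := dim_subvs u; rewrite dim_u in dimS.
have BE i j : (A *m S + S *m A^T) i j = w (D (b i)) (b j) + w (b i) (D (b j)).
  rewrite !Db (linear_form_sum _ _ (wl _)) (linear_form_sum _ _ (wr _)) mxE; congr (_ + _).
    by rewrite mxE; apply: eq_bigr => k _; rewrite SE.
  by rewrite mxE; apply: eq_bigr => k _; rewrite SE [A^T _ _]mxE mulrC.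
apply: (@lefschetz _ _ S); rewrite ?pnatr_eq0 ?dimS //.
  by rewrite linearD /= !trmx_mul trmxK skS mulNmx mulmxN opprD addrC.
by move=> i j k l; rewrite !BE !SE; apply: rel.
Qed.

(** The ordinals change from the dimension of u, known only propositionally to be
    6, to a literal 6; hence the detour through a statement for any dimension. *)
Lemma symplectic_basis (B : 'M[R]_(\dim {:subvs_of u})) :
  sp_mx (lfmx (ad_on br u z)) B ->
  exists (f : 'I_6 -> V) (M : 'M[R]_6),
    [/\ forall i, f i \in u,
        forall v, v \in u -> exists c : 'I_6 -> R, v = \sum_i c i *: f i,
        forall i, br z (f i) = \sum_k M i k *: f k &
        M *m std_mx 6 + std_mx 6 *m M^T = 0].
Proof.
move=> [skB uB AB]; set A := lfmx _ in AB.
have char2 : (2%:R : R) != 0 by rewrite pnatr_eq0.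
have [P uP PB] := darboux char2 skB uB.
suff : exists (f : 'I_(\dim {:subvs_of u}) -> V) (M : 'M[R]_(\dim {:subvs_of u})),
    [/\ forall i, f i \in u,
        forall v, v \in u -> exists c, v = \sum_i c i *: f i,
        forall i, br z (f i) = \sum_k M i k *: f k &
        M *m std_mx _ + std_mx _ *m M^T = 0].
  by rewrite dim_subvs dim_u.
pose b (i : 'I_(\dim {:subvs_of u})) := vsval vb`_i.
pose f i := \sum_j P i j *: b j.
have bf j : b j = \sum_i invmx P j i *: f i.
  under eq_bigr do rewrite scaler_sumr.
  rewrite exchange_big /= (bigD1 j) //= [X in _ + X]big1 ?addr0 => [|k kj].
    have /matrixP /(_ j j) := mulVmx uP; rewrite !mxE eqxx mulr1n => E.
    by rewrite -[LHS]scale1r -E scaler_suml; apply: eq_bigr => i _; rewrite scalerA.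
  have /matrixP /(_ j k) := mulVmx uP; rewrite !mxE eq_sym (negbTE kj) mulr0n => E.
  by rewrite -[RHS](scale0r (b k)) -E scaler_suml; apply: eq_bigr => i _; rewrite scalerA.
exists f, (P *m A *m invmx P); split.
- by move=> i; apply: memv_suml => j _; apply/memvZ/subvsP.
- move=> v vu; exists (fun i => \sum_j coord vb j (vsproj u v) * invmx P j i).
  rewrite -{1}(vsprojK vu) {1}(coord_basis (vbasisP _) (memvf (vsproj u v))) linear_sum.
  rewrite (eq_bigr (fun j => \sum_i (coord vb j (vsproj u v) * invmx P j i) *: f i)) => [|j _].
    by rewrite exchange_big; apply: eq_bigr => i _; rewrite scaler_suml.
  by rewrite linearZ /= -/(b j) bf scaler_sumr; apply: eq_bigr => i _; rewrite scalerA.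
- move=> i; rewrite linear_sumr.
  rewrite (eq_bigr (fun j => \sum_k (P i j * (A *m invmx P) j k) *: f k)) => [|j _].
    rewrite exchange_big; apply: eq_bigr => k _; rewrite -scaler_suml -mulmxA; congr (_ *: _).
    by rewrite mxE.
  rewrite linearZr_LR /= ad_on_basis // scaler_sumr.
  rewrite (eq_bigr (fun l => \sum_k (P i j * (A j l * invmx P l k)) *: f k)) => [|l _].
    rewrite exchange_big; apply: eq_bigr => k _; rewrite -scaler_suml mxE mulr_sumr.
    by [].
  by rewrite -/(b l) bf !scaler_sumr; apply: eq_bigr => k _; rewrite !scalerA mulrA.
- rewrite -PB !trmx_mul trmx_inv !mulmxA -(mulmxA _ (invmx P) P) mulVmx // mulmx1.
  rewrite -(mulmxA _ P^T (invmx _)) mulmxV ?unitmx_tr // mulmx1.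
  by rewrite -mulmxDl -(mulmxA P A) -(mulmxA P B) -mulmxDr AB mulmx0 mul0mx.
Qed.

(** The hypotheses describe a = w^2 / 2 + t /\ rho on a semidirect product with
    abelian ideal and derivation D.  Each bracket contributes a factor t; in the
    w-part D . w = 0 makes the terms cancel, in the rho-part t /\ t does. *)
Lemma closed_of_split (a : kform V 4) (D : V -> V) (w : V -> V -> R) (rho : V -> V -> V -> R)
    (t : V -> R) :
  (forall c d x y v, w (c *: x - d *: y) v = c * w x v - d * w y v) ->
  (forall x y, w y x = - w x y) ->
  (forall c d x y v r, rho (c *: x - d *: y) v r = c * rho x v r - d * rho y v r) ->
  (forall x y v, rho y x v = - rho x y v) -> (forall x y v, rho x v y = - rho x y v) ->
  (forall c d x y, t (c *: x - d *: y) = c * t x - d * t y) ->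
  (forall x, t (D x) = 0) -> (forall x y, w (D x) y + w x (D y) = 0) ->
  (forall x y, br x y = t x *: D y - t y *: D x) ->
  (forall x y v r, a (arg4 x y v r) = w x y * w v r - w x v * w y r + w x r * w y v
     + t x * rho y v r - t y * rho x v r + t v * rho x y r - t r * rho x y v) ->
  forall x, ext_d br a x = 0.
Proof.
move=> wl wC rl r12 r23 tl tD wD brE aE x; rewrite (arg5E x).
move: (x _) (x _) (x _) (x _) (x _) => x0 x1 x2 x3 x4 {x}.
have wDC p q : w (D p) q = w (D q) p.
  by rewrite [RHS]wC; apply/eqP; rewrite -addr_eq0 wD.
have tb p q : t (br p q) = 0 by rewrite brE tl !tD !mulr0 subrr.
have wb p q v : w (br p q) v = t p * w (D q) v - t q * w (D p) v by rewrite brE wl.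
have wb' p q v : w v (br p q) = t q * w (D p) v - t p * w (D q) v.
  by rewrite wC wb opprB.
have rb p q v r : rho (br p q) v r = t p * rho (D q) v r - t q * rho (D p) v r.
  by rewrite brE rl.
have rb2 p q v r : rho v (br p q) r = t q * rho (D p) v r - t p * rho (D q) v r.
  by rewrite r12 rb opprB.
have rb3 p q v r : rho v r (br p q) = t p * rho (D q) v r - t q * rho (D p) v r.
  by rewrite r23 rb2 opprB.
rewrite ext_d4 !aE !tb !wb !wb' !rb !rb2 !rb3.
rewrite (wDC x1 x0) (wDC x2 x0) (wDC x3 x0) (wDC x4 x0) (wDC x2 x1) (wDC x3 x1) (wDC x4 x1).
rewrite (wDC x3 x2) (wDC x4 x2) (wDC x4 x3); clear; ring.
Qed.
End NormalForm.

Section Existence.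
Context {R : realType} {V : vectType R} (br : {bilinear V -> V -> V}).
Variables (u : {vspace V}) (z : V).
Hypotheses (dim_V : \dim {:V} = 7%N) (dim_u : \dim u = 6%N) (zu : z \notin u).
Hypothesis ideal_u : is_abelian_ideal br u.

(** For the split signature the two vectors in each of the first two planes of a
    Darboux basis are interchanged, to match the negative coefficients of e^12 and
    e^34 in omega2.  The default value i fixes the remaining indices. *)
Definition slot (eps : bool) (i : nat) : nat :=
  if eps then nth i [:: 1; 0; 3; 2]%N i else i.

(** A Darboux basis of u, in the order given by [slot], followed by z. *)
Definition frame (eps : bool) (f : 'I_6 -> V) : 7.-tuple V :=
  [tuple nth z [seq f (inord (slot eps j)) | j <- iota 0 6] i | i < 7].

Lemma frame_slot eps f (i : 'I_6) : (frame eps f)`_(slot eps i) = f i.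
Proof.
have li : (slot eps i < 7)%N by case: i eps => [[|[|[|[|[|[|//]]]]]] li] [].
rewrite -(tnth_nth 0 _ (Ordinal li)) tnth_mktuple /=.
by case: i eps {li} => [[|[|[|[|[|[|//]]]]]] li] []; congr (f _); apply: val_inj; rewrite /= inordK.
Qed.

Lemma frame_last eps f : (frame eps f)`_6 = z.
Proof. by rewrite -[6%N]/(val (ord_max : 'I_7)) -tnth_nth tnth_mktuple. Qed.

Lemma std_mx_frame eps (e : 7.-tuple V) (f : 'I_6 -> V) : basis_of fullv e ->
  (forall i : 'I_6, e`_(slot eps i) = f i) ->
  forall i j, omega2 eps (crds e (f i)) (crds e (f j)) = std_mx 6 i j :> R.
Proof.
move=> be fe.
have crdf (i : 'I_6) k : (k < 7)%N -> crd e k (f i) = (k == slot eps i)%:R.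
  move=> lk; rewrite -fe crd_basis //.
  by case: i eps {fe} => [[|[|[|[|[|[|//]]]]]] li] [].
move=> i j; rewrite /omega2 /coord_form /= /crds !crdf // !mxE {fe crdf}.
case: i => [[|[|[|[|[|[|//]]]]]] li]; case: j => [[|[|[|[|[|[|//]]]]]] lj]; case: eps; rewrite /model_eps /=; ring.
Qed.

Lemma frame_basis eps f : (forall i, f i \in u) ->
  (forall v, v \in u -> exists c : 'I_6 -> R, v = \sum_i c i *: f i) ->
  basis_of fullv (frame eps f).
Proof.
move=> fu fspan.
have [t [tz tu ut]] := hyperplane_functional (etrans dim_V (congr1 S (esym dim_u))) zu.
rewrite basisEdim size_tuple dim_V leqnn andbT; apply/subvP => x _.
rewrite -(subrK (t x *: z) x); apply: memvD.
  have [c ->] := fspan _ (ut x); apply: memv_suml => i _; apply/memvZ/memv_span.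
  rewrite -(frame_slot eps); apply: mem_nth; rewrite size_tuple.
  by case: i eps => [[|[|[|[|[|[|//]]]]]] li] [].
by apply/memvZ/memv_span; rewrite -(frame_last eps f); apply: mem_nth; rewrite size_tuple.
Qed.

(** The frame of a Darboux basis is adapted to a cocalibrated structure, since
    [star_split] puts the dual 4-form into the form of [closed_of_split]. *)
Lemma sp_cocalibrated eps B : (forall x, br x x = 0) ->
  sp_mx (lfmx (ad_on br u z)) B ->
  exists phi (metric : {symmetric V}) vol,
    cocalibrated (model eps) br phi metric vol /\ nondegenerate_on metric u.
Proof.
move=> brxx spB.
have [f [M [fu fspan Df MB]]] := symplectic_basis dim_u ideal_u spB.
pose e := frame eps f; have be : basis_of fullv e by apply: frame_basis.
have fe (i : 'I_6) : e`_(slot eps i) = f i by apply: frame_slot.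
have e6 : e`_6 = z by apply: frame_last.
have crd6f i : crd e 6 (f i) = 0.
  rewrite -fe crd_basis //; case: i eps {e be fe e6} => [[|[|[|[|[|[|//]]]]]] li] [] //.
have crdz k : (k < 7)%N -> crd e k z = (k == 6%N)%:R by move=> lk; rewrite -e6 crd_basis.
have crd6u x : x \in u -> crd e 6 x = 0.
  move=> /fspan [c ->]; rewrite (linear_form_sum _ _ (crdP e 6)) big1 // => i _.
  by rewrite crd6f mulr0.
have xu x : x - crd e 6 x *: z \in u.
  have [t [tz tu ut]] := hyperplane_functional (etrans dim_V (congr1 S (esym dim_u))) zu.
  have -> : crd e 6 x = t x; last exact: ut.
  have /eqP := crd6u _ (ut x); rewrite -scaleNr addrC crdP crdz // mulr1 addrC subr_eq0.
  by move=> /eqP.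
have brC x y : br x y = - br y x.
  by have /eqP := brxx (x + y); rewrite linearDl /= !linearD /= !brxx add0r addr0 addr_eq0 => /eqP.
pose t := crd e 6; pose D := br z.
have Dz : D z = 0 by apply: brxx.
have brE x y : br x y = t x *: D y - t y *: D x.
  have /eqP := ideal_u.2 _ _ (xu x) (xu y).
  rewrite !linearBl /= !linearB /= !linearZl_LR /= !linearZr_LR /= brxx !scaler0.
  rewrite !oppr0 addr0 [br x z]brC scalerN opprK -addrA addr_eq0 => /eqP ->.
  by rewrite opprB.
have tD x : t (D x) = 0.
  rewrite -(subrK (t x *: z) x) addrC /D linearP /= brxx scaler0 add0r.
  by apply/crd6u/ideal_u.1/xu.
have crdB i c d x y : crd e i (c *: x - d *: y) = c * crd e i x - d * crd e i y.
  by rewrite crdP -scaleNr -[_ *: y]addr0 crdP /crd linear0 addr0 mulNr.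
pose w x y : R := omega2 eps (crds e x) (crds e y).
pose rho x y v : R := rho3 (crds e x) (crds e y) (crds e v).
have aE x y v r : form_of e (starlist eps) (arg4 x y v r) = w x y * w v r - w x v * w y r
    + w x r * w y v + t x * rho y v r - t y * rho x v r + t v * rho x y r - t r * rho x y v.
  by rewrite arg4E form_of_coord_form //; apply: star_split.
have wl a x x' y : w (a *: x + x') y = a * w x y + w x' y.
  rewrite /w /omega2 /coord_form /= /crds !crdP; ring.
have wC x y : w y x = - w x y by rewrite /w /omega2 /coord_form /=; ring.
have wr y a x x' : w y (a *: x + x') = a * w y x + w y x'.
  by rewrite wC wl opprD -mulrN -!wC.
have wlB c d x y v : w (c *: x - d *: y) v = c * w x v - d * w y v.
  rewrite /w /omega2 /coord_form /= /crds !crdB; ring.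
have wz x : w z x = 0 by rewrite /w /omega2 /coord_form /= /crds !crdz //=; ring.
have wf i j : w (f i) (f j) = std_mx 6 i j by apply: std_mx_frame.
have rl c d x y v r : rho (c *: x - d *: y) v r = c * rho x v r - d * rho y v r.
  rewrite /rho /rho3 /coord_form /= /crds !crdB; ring.
have r12 x y v : rho y x v = - rho x y v by rewrite /rho /rho3 /coord_form /=; ring.
have r23 x y v : rho x v y = - rho x y v by rewrite /rho /rho3 /coord_form /=; ring.
clearbody w rho.
(* Invariance holds on the basis by the matrix equation, and along z because z
   lies in the radical of w and D z = 0. *)
have wD x y : w (D x) y + w x (D y) = 0.
  pose lieD x y := w (D x) y + w x (D y).
  have dl y' a x1 x2 : lieD (a *: x1 + x2) y' = a * lieD x1 y' + lieD x2 y'.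
    by rewrite /lieD /D linearP /= !wl; ring.
  have dr y' a x1 x2 : lieD y' (a *: x1 + x2) = a * lieD y' x1 + lieD y' x2.
    by rewrite /lieD /D linearP /= !wr; ring.
  have dzl y' : lieD z y' = 0.
    by rewrite /lieD Dz wz addr0 -(subrr (1 *: z)) wlB subrr.
  have dzr y' : lieD y' z = 0 by rewrite /lieD addrC wC [w _ z]wC -opprD -/(lieD z y') dzl oppr0.
  have [c cE] := fspan _ (xu x); have [c' cE'] := fspan _ (xu y).
  rewrite -/(lieD x y) -(subrK (crd e 6 x *: z) x) addrC dl dzl mulr0 add0r cE.
  rewrite -(subrK (crd e 6 y *: z) y) addrC dr dzr mulr0 add0r cE'.
  rewrite (linear_form_sum _ _ (dl _)) big1 // => i _.
  rewrite (linear_form_sum _ _ (dr _)) big1 ?mulr0 // => j _.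
  have /matrixP /(_ i j) := MB; rewrite !mxE => E.
  rewrite /lieD /D !Df (linear_form_sum _ _ (fun a x x' => wl a x x' (f j))) (linear_form_sum _ _ (wr _)).
  rewrite (_ : _ + _ = 0) ?mulr0 // -[RHS]E; congr (_ + _); apply: eq_bigr => k _.
    by rewrite wf.
  by rewrite wf [M^T _ _]mxE mulrC.
have closed := closed_of_split wlB wC rl r12 r23 (crdB 6%N) tD wD brE aE.
exists (model eps e), (model_ip eps e), (mono e (iota 0%N 7%N) (k := 7)); split.
  exact: model_cocalibrated.
apply/eqP; rewrite -subv0; apply/subvP => x; rewrite memv_cap memv0 => /andP [x_u /mem_orthovP xo].
rewrite (crd_sum x be) big1 // => k _.
suff -> : crd e k x = 0 by rewrite scale0r.
have [->|k6] := eqVneq (k : nat) 6%N; first exact: crd6u.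
have eku : e`_k \in u.
  by have := xu e`_k; rewrite crd_basis // eq_sym (negbTE k6) scale0r subr0.
by rewrite (crd_ip eps _ _ be); have /= -> := xo _ eku; rewrite mulr0.
Qed.

(** For the definite model, g(x, x) is a sum of squares of coordinates. *)
Lemma cocalibrated_nondegenerate phi (metric : {symmetric V}) vol :
  cocalibrated (model false) br phi metric vol -> nondegenerate_on metric u.
Proof.
move=> [[_ [e ad_e]] ind _]; have [gE _] := induces_ip ind ad_e; have [be _] := ad_e.
apply/eqP; rewrite -subv0; apply/subvP => x; rewrite memv_cap memv0 => /andP [x_u /mem_orthovP xo].
have sig1 i : model_sign false i = 1 by rewrite /model_sign /model_eps if_same.
have /eqP := xo _ x_u; rewrite gE /model_ip psumr_eq0 => [/allP s0|i _]; last first.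
  by rewrite sig1 mul1r -expr2 sqr_ge0.
rewrite (crd_sum x be) big1 // => k _.
have := s0 k (mem_index_enum k); rewrite /= sig1 mul1r mulf_eq0 orbb => /eqP ->.
by rewrite scale0r.
Qed.
End Existence.

(** * The equivalence *)

Theorem theorem1p1 (R : realType) (g : vectType R)
    (br : {bilinear g -> g -> g}) (u : {vspace g}) (e7 : g)
    (omega : {skew_symmetric (subvs_of u)})
    (dim_g : \dim {:g} = 7%N) (lie_br : is_lie_bracket br)
    (dim_u : \dim u = 6%N) (ideal_u : is_abelian_ideal br u)
    (e7_notin_u : e7 \notin u) (omega_nondeg : nondegenerate omega) :
  [<->
    exists (phi : kform g 3) (metric : {symmetric g}) (vol : kform g 7),
      cocalibrated G2_model br phi metric vol;
    exists (phi : kform g 3) (metric : {symmetric g}) (vol : kform g 7),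
      cocalibrated G2star_model br phi metric vol /\ nondegenerate_on metric u;
    exists2 f : 'End(subvs_of u), in_sp omega f & is_similar (ad_on br u e7) f;
    exists2 s : seq (complex R * nat),
      is_jordan_form (complex_matrix (ad_on br u e7)) s &
      (forall (k : nat) (l : complex R), l != 0 ->
         count_mem (l, k) s = count_mem (- l, k) s) /\
      (forall k : nat, (0 < k)%N -> ~~ odd (count_mem (0, (2 * k).-1) s))].
Proof.
have spP := sp_similarP (ad_on br u e7) omega_nondeg.
tfae.
- move=> [phi [metric [vol coc]]].
  have [B spB] := cocalibrated_sp dim_g dim_u e7_notin_u ideal_u (eps := false) coc
    (cocalibrated_nondegenerate u coc).
  exact: (sp_cocalibrated dim_g dim_u e7_notin_u ideal_u true lie_br.1 spB).
- move=> [phi [metric [vol [coc ndu]]]]; apply/spP.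
  exact: (cocalibrated_sp dim_g dim_u e7_notin_u ideal_u (eps := true) coc ndu).
- by move=> /spP /sp_mx_jordan; rewrite complex_matrixE.
- rewrite complex_matrixE => /sp_mx_jordan [B spB].
  have [phi [metric [vol [coc _]]]] :=
    sp_cocalibrated dim_g dim_u e7_notin_u ideal_u false lie_br.1 spB.
  by exists phi, metric, vol.
Qed.
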